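(* Let $a^2\ge0$, $b^2>0$, $c^2>0$, $k\in\mathbb Z\setminus\{0\}$ and $R\in(0,\infty]$. Let $(u,v)$ be a solution on $(0,R)$ of $$u''+\frac{u'}{r}-\frac{k^2u}{r^2}=h(u,v),\qquad v''+\frac{v'}{r}=g(u,v),$$ with $u(0)=0$, $v'(0)=0$, $u(R)=\frac{s_+}{\sqrt2}$, $v(R)=-\frac{s_+}{\sqrt6}$ (limits as $r\to\infty$ if $R=\infty$), such that $u>0$ and $v<0$ on $(0,R)$. Then: (i) if $b^4<3a^2c^2$, then $u'>0$ and $v'>0$ on $(0,R)$; (ii) if $b^4=3a^2c^2$, then $u'>0$ on $(0,R)$ and $v\equiv-\frac{s_+}{\sqrt6}$; (iii) if $b^4>3a^2c^2$, then $u'>0$ and $v'<0$ on $(0,R)$.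
   Context: $s_+=\frac{b^2+\sqrt{b^4+24a^2c^2}}{4c^2}$, $h(u,v)=u\big[-a^2+\sqrt{\tfrac23}b^2v+c^2(u^2+v^2)\big]$, $g(u,v)=v\big[-a^2-\tfrac1{\sqrt6}b^2v+c^2(u^2+v^2)\big]+\tfrac1{\sqrt6}b^2u^2$. *)

(* Defs.v *)
From Stdlib Require Import Reals.
From Coquelicot Require Import Coquelicot.
Open Scope R_scope.

Definition s_plus (a b c : R) : R :=
  (b ^ 2 + sqrt (b ^ 4 + 24 * a ^ 2 * c ^ 2)) / (4 * c ^ 2).

Definition h_fun (a b c u v : R) : R :=
  u * (- a ^ 2 + sqrt (2 / 3) * b ^ 2 * v + c ^ 2 * (u ^ 2 + v ^ 2)).

Definition g_fun (a b c u v : R) : R :=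
  v * (- a ^ 2 - / sqrt 6 * b ^ 2 * v + c ^ 2 * (u ^ 2 + v ^ 2))
  + / sqrt 6 * b ^ 2 * u ^ 2.

Definition end_filter (Rend : Rbar) : (R -> Prop) -> Prop :=
  match Rend with
  | Finite r => at_left r
  | p_infty => Rbar_locally p_infty
  | m_infty => Rbar_locally m_infty
  end.

Definition in_open (Rend : Rbar) (r : R) : Prop :=
  0 < r /\ Rbar_lt (Finite r) Rend.

Definition is_solution (a b c : R) (k : Z) (Rend : Rbar) (u v : R -> R) : Prop :=
  forall r, in_open Rend r ->
    ex_derive u r /\ ex_derive (Derive u) r /\
    ex_derive v r /\ ex_derive (Derive v) r /\
    Derive (Derive u) r + Derive u r / r - (IZR k) ^ 2 * u r / r ^ 2
      = h_fun a b c (u r) (v r) /\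
    Derive (Derive v) r + Derive v r / r = g_fun a b c (u r) (v r).

(* Main.v *)
Require Import Defs.
From Stdlib Require Import Reals Lra Classical ClassicalEpsilon.
From Coquelicot Require Import Coquelicot.
Open Scope R_scope.

(** With x = sqrt 2 u and y = - e sqrt 6 v, where e = 1 if s_plus <= b^2/c^2 and e = -1
    otherwise, the maximum principle gives 0 < x < s and y < m := e s when b^4 <> 3a^2c^2,
    and in that range the system is cooperative. Monotonicity then follows from the moving plane
    method. Instead of reflecting in the plane, compare x(rho) with x(sigma) for all pairs
    sigma < rho with rho + sigma >= 2 lambda. At a contact point on the line
    rho + sigma = 2 lambda the Lagrange multiplier contributes to the radial Laplacians with the
    good sign, so x(rho) - x(sigma) and y(rho) - y(sigma) stay positive while lambda decreases
    from the end of the interval to 0. Near the end one minimizes the difference quotients by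
    psi(rho) + psi(sigma), with psi constant if R is infinite (the linearization at (s, m) is then
    coercive for suitable weights) and psi = const - r^2 if R is finite (narrow domain). *)

(** * Derivatives at one-sided minima and contact points *)

(** The two components have to be bounded together. At a maximum of [X] the equation bounds [X] in
    terms of [Y]; inserting this bound into the equation at a maximum of [Y] cancels the cubic terms
    and leaves a quadratic with root [m]. Strictness has a single source, the term [K X / r^2]: it
    decreases in r for fixed [X], so equality of [X] at two radii is impossible, and the strict
    decrease of [g] in x hands this on to [Y]. For a pair that shrinks to one point the gap is of no
    help; there the derivatives are shown positive by comparing third derivatives. The origin is the
    other obstacle. The value [v(0)] is not prescribed and 0 is not an interior point, so extrema
    and contacts of [Y] at 0 are excluded through the quantity [r q], whose derivative is [r g] and
    which tends to 0. If [b^4 = 3a^2c^2], the factor y - s splits off from [g], so [Y] is constant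
    and a scalar equation for [X] remains. *)

Lemma is_derive_pos_increase (f : R -> R) (x d : R) :
  is_derive f x d -> 0 < d ->
  exists e, 0 < e /\ forall t, 0 < t < e -> f x < f (x + t) /\ f (x - t) < f x.
Proof.
intros Hd Hp. apply is_derive_Reals in Hd.
destruct (Hd d Hp) as [e He].
exists e; split; [apply cond_pos|]. intros t Ht.
assert (H1 : Rabs ((f (x + t) - f x) / t - d) < d).
{ apply He; [lra|rewrite Rabs_pos_eq; lra]. }
assert (H2 : Rabs ((f (x + - t) - f x) / - t - d) < d).
{ apply He; [lra|rewrite Rabs_Ropp, Rabs_pos_eq; lra]. }
apply Rabs_def2 in H1. apply Rabs_def2 in H2.
replace (x - t) with (x + - t) by ring.
set (A := f (x + t) - f x) in *. set (B := f (x + - t) - f x) in *.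
assert (HA : A = A / t * t) by (field; lra).
assert (HB : B = - (B / - t * t)) by (field; lra).
assert (0 < A / t * t) by (apply Rmult_lt_0_compat; lra).
assert (0 < B / - t * t) by (apply Rmult_lt_0_compat; lra).
unfold A, B in *. lra.
Qed.

Lemma is_derive_neg_decrease (f : R -> R) (x d : R) :
  is_derive f x d -> d < 0 ->
  exists e, 0 < e /\ forall t, 0 < t < e -> f (x + t) < f x /\ f x < f (x - t).
Proof.
intros Hd Hn.
destruct (is_derive_pos_increase (fun t => - f t) x (- d)) as [e [He H]].
- apply (is_derive_opp f x d Hd).
- lra.
- exists e; split; [easy|]. intros t Ht. specialize (H t Ht). simpl in H. lra.
Qed.

Lemma right_min_derive_ge0 (f : R -> R) (x d e : R) :
  is_derive f x d -> 0 < e -> (forall t, 0 < t < e -> f x <= f (x + t)) -> 0 <= d.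
Proof.
intros Hd He H. destruct (Rle_lt_dec 0 d) as [|Hn]; [easy|].
destruct (is_derive_neg_decrease f x d Hd Hn) as [e' [He' H']].
assert (Hm : 0 < Rmin e e' / 2 < Rmin e e').
{ assert (0 < Rmin e e') by (apply Rmin_glb_lt; lra). lra. }
generalize (Rmin_l e e') (Rmin_r e e'); intros.
specialize (H (Rmin e e' / 2)). specialize (H' (Rmin e e' / 2)). lra.
Qed.

Lemma left_min_derive_le0 (f : R -> R) (x d e : R) :
  is_derive f x d -> 0 < e -> (forall t, 0 < t < e -> f x <= f (x - t)) -> d <= 0.
Proof.
intros Hd He H. destruct (Rle_lt_dec d 0) as [|Hn]; [easy|].
destruct (is_derive_pos_increase f x d Hd Hn) as [e' [He' H']].
assert (Hm : 0 < Rmin e e' / 2 < Rmin e e').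
{ assert (0 < Rmin e e') by (apply Rmin_glb_lt; lra). lra. }
generalize (Rmin_l e e') (Rmin_r e e'); intros.
specialize (H (Rmin e e' / 2)). specialize (H' (Rmin e e' / 2)). lra.
Qed.

Lemma is_derive_MVT (f g : R -> R) (a b : R) :
  a < b -> (forall t, a <= t <= b -> is_derive f t (g t)) ->
  exists c, a < c < b /\ f b - f a = g c * (b - a).
Proof.
intros Hab H.
destruct (MVT_cor2 f g a b Hab) as [c [H1 H2]].
- intros c Hc. apply is_derive_Reals. now apply H.
- exists c; now split.
Qed.

Lemma neg_derive_decrease (f g : R -> R) (x e : R) :
  (forall t, x <= t < x + e -> is_derive f t (g t)) ->
  (forall t, x < t < x + e -> g t < 0) ->
  forall t, x < t < x + e -> f t < f x.
Proof.
intros Hd Hn t Ht.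
destruct (is_derive_MVT f g x t) as [c [Hc E]]; [easy|intros; apply Hd; lra|].
specialize (Hn c). assert (0 < - g c * (t - x)) by (apply Rmult_lt_0_compat; lra). lra.
Qed.

Lemma second_derive_right_min (f g : R -> R) (x d e : R) :
  0 < e -> (forall t, x <= t < x + e -> is_derive f t (g t)) -> g x = 0 ->
  is_derive g x d -> (forall t, 0 < t < e -> f x <= f (x + t)) -> 0 <= d.
Proof.
intros He Hf Hg Hd H. destruct (Rle_lt_dec 0 d) as [|Hn]; [easy|].
destruct (is_derive_neg_decrease g x d Hd Hn) as [e' [He' H']].
set (r := Rmin e e').
assert (0 < r) by (apply Rmin_glb_lt; lra).
generalize (Rmin_l e e') (Rmin_r e e'); fold r; intros.
assert (f (x + r / 2) < f x).
{ apply (neg_derive_decrease f g x r); [intros; apply Hf; lra| |lra].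
  intros t Ht. specialize (H' (t - x)). replace (x + (t - x)) with t in H' by ring. lra. }
specialize (H (r / 2)). lra.
Qed.

Lemma third_derive_right_min (f g h : R -> R) (x d e : R) :
  0 < e -> (forall t, x <= t < x + e -> is_derive f t (g t)) ->
  (forall t, x <= t < x + e -> is_derive g t (h t)) -> g x = 0 -> h x = 0 ->
  is_derive h x d -> (forall t, 0 < t < e -> f x <= f (x + t)) -> 0 <= d.
Proof.
intros He Hf Hg Hgx Hhx Hd H. destruct (Rle_lt_dec 0 d) as [|Hn]; [easy|].
destruct (is_derive_neg_decrease h x d Hd Hn) as [e' [He' H']].
set (r := Rmin e e').
assert (0 < r) by (apply Rmin_glb_lt; lra).
generalize (Rmin_l e e') (Rmin_r e e'); fold r; intros.
assert (f (x + r / 2) < f x).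
{ apply (neg_derive_decrease f g x r); [intros; apply Hf; lra| |lra].
  intros t Ht. rewrite <- Hgx. apply (neg_derive_decrease g h x r); [intros; apply Hg; lra| |lra].
  intros t' Ht'.
  specialize (H' (t' - x)). replace (x + (t' - x)) with t' in H' by ring. lra. }
specialize (H (r / 2)). lra.
Qed.

Lemma is_derive_comp_add (f : R -> R) (r t d : R) :
  is_derive f (r + t) d -> is_derive (fun t => f (r + t)) t d.
Proof.
intros H.
replace d with (scal 1 d) by (unfold scal; simpl; unfold mult; simpl; ring).
apply (is_derive_comp f (fun t => r + t)); [exact H|].
auto_derive; [easy|ring].
Qed.

Lemma is_derive_comp_sub (f : R -> R) (r t d : R) :
  is_derive f (r - t) d -> is_derive (fun t => f (r - t)) t (- d).
Proof.
intros H.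
replace (- d) with (scal (-1) d) by (unfold scal; simpl; unfold mult; simpl; ring).
apply (is_derive_comp f (fun t => r - t)); [exact H|].
auto_derive; [easy|ring].
Qed.

(* At a contact point of P(rho) >= Q(sigma) on the half plane rho + sigma >= const,
   the radial Laplacians P'' + P'/rho and Q'' + Q'/sigma are still ordered: the
   multiplier of the constraint enters with the good sign. *)
Lemma contact_radial_laplacian (P P1 Q Q1 : R -> R) (rho sg P2 Q2 e : R) :
  0 < e -> 0 < rho -> 0 < sg ->
  (forall t, rho - e < t < rho + e -> is_derive P t (P1 t)) -> is_derive P1 rho P2 ->
  (forall t, sg - e < t < sg + e -> is_derive Q t (Q1 t)) -> is_derive Q1 sg Q2 ->
  P rho = Q sg ->
  (forall r s, rho - e < r < rho + e -> sg - e < s < sg + e -> rho + sg <= r + s ->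
    Q s <= P r) ->
  Q2 + Q1 sg / sg <= P2 + P1 rho / rho.
Proof.
intros He Hr Hs HP HP1 HQ HQ1 E H.
(* Moving rho alone to the right raises the sum and so stays admissible. *)
assert (H0 : 0 <= P1 rho).
{ apply (right_min_derive_ge0 P rho _ e); [apply HP; lra|easy|].
  intros t Ht. rewrite E. apply H; lra. }
(* Motion along the line of constant sum. The minimum of [phi] at 0 forces [Q1 sg = - P1 rho], the
   common value being the multiplier up to sign. *)
pose (phi := fun t => P (rho + t) - Q (sg - t)).
pose (phi1 := fun t => P1 (rho + t) + Q1 (sg - t)).
assert (D : forall t, - e < t < e -> is_derive phi t (phi1 t)).
{ intros t Ht. unfold phi, phi1.
  replace (P1 (rho + t) + Q1 (sg - t)) with (P1 (rho + t) - - Q1 (sg - t)) by ring.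
  apply (is_derive_minus (fun t => P (rho + t)) (fun t => Q (sg - t))).
  - apply is_derive_comp_add, HP; lra.
  - apply is_derive_comp_sub, HQ; lra. }
assert (D1 : is_derive phi1 0 (P2 - Q2)).
{ unfold phi1. replace (P2 - Q2) with (P2 + - Q2) by ring.
  apply (is_derive_plus (fun t => P1 (rho + t)) (fun t => Q1 (sg - t))).
  - apply is_derive_comp_add. now rewrite Rplus_0_r.
  - apply is_derive_comp_sub. now rewrite Rminus_0_r. }
assert (M : forall t, - e < t < e -> phi 0 <= phi t).
{ intros t Ht. unfold phi. rewrite Rplus_0_r, Rminus_0_r, E.
  assert (Q (sg - t) <= P (rho + t)) by (apply H; lra). lra. }
assert (Z : phi1 0 = 0).
{ apply Rle_antisym.
  - apply (left_min_derive_le0 phi 0 _ e); [apply D; lra|easy|].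
    intros t Ht. apply M; lra.
  - apply (right_min_derive_ge0 phi 0 _ e); [apply D; lra|easy|].
    intros t Ht. apply M; lra. }
assert (H2 : 0 <= P2 - Q2).
{ apply (second_derive_right_min phi phi1 0 _ e); try easy.
  - intros t Ht. apply D; lra.
  - intros t Ht. apply M; lra. }
unfold phi1 in Z. rewrite Rplus_0_r, Rminus_0_r in Z.
replace (Q1 sg) with (- P1 rho) by lra.
assert (0 <= P1 rho / rho) by (apply Rdiv_le_0_compat; lra).
assert (0 <= P1 rho / sg) by (apply Rdiv_le_0_compat; lra).
unfold Rdiv in *. lra.
Qed.

(** The function f(r + t) - f(r - t) is odd in t and has zero first derivative at 0 because
    [g r = 0], so its sign for small t > 0 is governed by its third derivative, which is [2 d]. *)
Lemma symmetric_third_derive (f g h : R -> R) (r d e : R) :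
  0 < e ->
  (forall t, r - e < t < r + e -> is_derive f t (g t)) ->
  (forall t, r - e < t < r + e -> is_derive g t (h t)) ->
  is_derive h r d -> g r = 0 ->
  (forall t, 0 < t < e -> f (r - t) <= f (r + t)) -> 0 <= d.
Proof.
intros He Hf Hg Hh Z H.
cut (0 <= d - - d); [lra|].
apply (third_derive_right_min (fun t => f (r + t) - f (r - t))
  (fun t => g (r + t) - - g (r - t)) (fun t => h (r + t) - h (r - t)) 0 _ e); try easy.
- intros t Ht. apply (is_derive_minus (fun t => f (r + t)) (fun t => f (r - t))).
  + apply is_derive_comp_add, Hf; lra.
  + apply is_derive_comp_sub, Hf; lra.
- intros t Ht.
  replace (h (r + t) - h (r - t)) with (h (r + t) - - - h (r - t)) by ring.
  apply (is_derive_minus (fun t => g (r + t)) (fun t => - g (r - t))).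
  + apply is_derive_comp_add, Hg; lra.
  + apply (is_derive_opp (fun t => g (r - t))). apply is_derive_comp_sub, Hg; lra.
- rewrite Rplus_0_r, Rminus_0_r, Z; ring.
- rewrite Rplus_0_r, Rminus_0_r; ring.
- apply (is_derive_minus (fun t => h (r + t)) (fun t => h (r - t))).
  + apply is_derive_comp_add. now rewrite Rplus_0_r.
  + apply is_derive_comp_sub. now rewrite Rminus_0_r.
- intros t Ht. rewrite Rplus_0_r, Rminus_0_r, Rplus_0_l. specialize (H t Ht). lra.
Qed.

(** * Compactness *)

(** A Lebesgue number argument: local radii are selected by choice and given to the gauge form of
    compactness. As [G] is inherited by smaller scales, the common scale found there serves at every
    point. *)
Lemma local_to_uniform_2d (a b c d : R) (G : R -> R -> R -> Prop) :
  (forall e e' x y, 0 < e' <= e -> G e x y -> G e' x y) ->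
  (forall u v, a <= u <= b -> c <= v <= d ->
    exists e, 0 < e /\ forall x y, Rabs (x - u) < e -> Rabs (y - v) < e -> G e x y) ->
  exists e, 0 < e /\ forall x y, a <= x <= b -> c <= y <= d -> G e x y.
Proof.
intros Gmon Gloc.
assert (H : forall u v, exists e : posreal, a <= u <= b -> c <= v <= d ->
  forall x y, Rabs (x - u) < e -> Rabs (y - v) < e -> G e x y).
{ intros u v. destruct (classic (a <= u <= b /\ c <= v <= d)) as [[Hu Hv]|N].
  - destruct (Gloc u v Hu Hv) as [e [He H]]. now exists (mkposreal e He).
  - exists (mkposreal 1 Rlt_0_1). tauto. }
destruct (compactness_value_2d a b c d
  (fun u v => proj1_sig (constructive_indefinite_description _ (H u v)))) as [e He].
exists e; split; [apply cond_pos|]. intros x y Hx Hy.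
apply NNPP; intros N. apply (He x y Hx Hy). intros [u [v [Hu [Hv [H1 [H2 H3]]]]]].
apply N. destruct (constructive_indefinite_description _ (H u v)) as [e' He']; simpl in *.
apply (Gmon e'); [split; [apply cond_pos|easy]|now apply He'].
Qed.

Lemma local_to_uniform (a b : R) (G : R -> R -> Prop) :
  (forall e e' x, 0 < e' <= e -> G e x -> G e' x) ->
  (forall u, a <= u <= b ->
    exists e, 0 < e /\ forall x, Rabs (x - u) < e -> G e x) ->
  exists e, 0 < e /\ forall x, a <= x <= b -> G e x.
Proof.
intros Gmon Gloc.
destruct (local_to_uniform_2d a b 0 0 (fun e x _ => G e x)) as [e [He H]].
- intros e e' x _; apply Gmon.
- intros u v Hu _. destruct (Gloc u Hu) as [e [He H]]. exists e; split; [easy|].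
  intros x _ Hx _. now apply H.
- exists e; split; [easy|]. intros x Hx. apply (H x 0); lra.
Qed.

(** Closedness of [S] is expressed by its open complement. Boundedness and a uniform gap below an
    infimum that is not attained are both written as properties inherited by smaller scales (the
    bound as [/ e]), so that compactness applies to each. *)
Lemma compact_min_2d (a b c d : R) (S : R -> R -> Prop) (Phi : R -> R -> R) :
  (forall u v, a <= u <= b -> c <= v <= d -> continuity_2d_pt Phi u v) ->
  (forall u v, ~ S u v -> locally_2d (fun x y => ~ S x y) u v) ->
  (exists u v, a <= u <= b /\ c <= v <= d /\ S u v) ->
  exists u v, (a <= u <= b /\ c <= v <= d /\ S u v) /\
    forall x y, a <= x <= b -> c <= y <= d -> S x y -> Phi u v <= Phi x y.
Proof.
intros Hc HS [u0 [v0 [Hu0 [Hv0 HS0]]]].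
assert (Hb : exists e, 0 < e /\ forall x y, a <= x <= b -> c <= y <= d -> - Phi x y <= / e).
{ apply (local_to_uniform_2d a b c d (fun e x y => - Phi x y <= / e)).
  - intros e e' x y He H. apply Rle_trans with (1 := H). apply Rinv_le_contravar; lra.
  - intros u v Hu Hv. destruct (Hc u v Hu Hv (mkposreal 1 Rlt_0_1)) as [e He]; simpl in He.
    set (k := / (Rabs (Phi u v) + 1)).
    assert (0 < Rabs (Phi u v) + 1) by (generalize (Rabs_pos (Phi u v)); lra).
    assert (Hk : 0 < k) by now apply Rinv_0_lt_compat.
    exists (Rmin e k). split; [apply Rmin_glb_lt; [apply cond_pos|easy]|].
    intros x y Hx Hy.
    assert (H1 : Rabs (Phi x y - Phi u v) < 1).
    { apply He; (eapply Rlt_le_trans; [eassumption|apply Rmin_l]). }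
    apply Rle_trans with (/ k).
    + unfold k; rewrite Rinv_inv. apply Rabs_def2 in H1.
      generalize (Rle_abs (- Phi u v)). rewrite Rabs_Ropp. lra.
    + apply Rinv_le_contravar; [apply Rmin_glb_lt; [apply cond_pos|easy]|apply Rmin_r]. }
destruct Hb as [e [He Hb]].
destruct (completeness (fun r => exists x y, a <= x <= b /\ c <= y <= d /\ S x y /\ r = - Phi x y))
  as [I [HI1 HI2]].
- exists (/ e). intros r [x [y [Hx [Hy [_ E]]]]]. rewrite E. now apply Hb.
- exists (- Phi u0 v0), u0, v0; auto.
- apply NNPP; intros N.
  assert (HN : forall x y, a <= x <= b -> c <= y <= d -> S x y -> - Phi x y < I).
  { intros x y Hx Hy HSx.
    destruct (Rle_lt_or_eq_dec (- Phi x y) I) as [|E]; [apply HI1; now exists x, y|easy|].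
    exfalso; apply N. exists x, y; split; [easy|]. intros x' y' Hx' Hy' HS'.
    assert (- Phi x' y' <= I) by (apply HI1; now exists x', y'). lra. }
  assert (HI : exists k, 0 < k /\ forall x y, a <= x <= b -> c <= y <= d -> S x y ->
    - Phi x y <= I - k).
  { apply (local_to_uniform_2d a b c d (fun k x y => S x y -> - Phi x y <= I - k)).
    - intros k k' x y Hk H HSx. specialize (H HSx). lra.
    - intros u v Hu Hv. destruct (classic (S u v)) as [HSu|HSu].
      + specialize (HN u v Hu Hv HSu).
        assert (Hk : 0 < (I + Phi u v) / 2) by lra.
        destruct (Hc u v Hu Hv (mkposreal _ Hk)) as [k0 Hk0]; simpl in Hk0.
        exists (Rmin k0 ((I + Phi u v) / 2)).
        split; [apply Rmin_glb_lt; [apply cond_pos|easy]|].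
        intros x y Hx Hy _.
        assert (H1 : Rabs (Phi x y - Phi u v) < (I + Phi u v) / 2).
        { apply Hk0; (eapply Rlt_le_trans; [eassumption|apply Rmin_l]). }
        apply Rabs_def2 in H1. generalize (Rmin_r k0 ((I + Phi u v) / 2)). lra.
      + destruct (HS u v HSu) as [k Hk]. exists k; split; [apply cond_pos|].
        intros x y Hx Hy HSx. exfalso. now apply (Hk x y). }
  destruct HI as [k [Hk HI]].
  assert (I <= I - k); [|lra].
  apply HI2. intros r [x [y [Hx [Hy [HSx E]]]]]. rewrite E. now apply HI.
Qed.

(** The alternative in the conclusion locates the maximum: at a point past the end of the interval a
    profile equals its limit [l], so a maximum point with [l < X r1] cannot lie there. *)
Lemma max_of_limit_le (X : R -> R) (l r0 : R) :
  (forall r, continuous X r) ->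
  (forall e, 0 < e -> exists N, forall r, N <= r -> Rabs (X r - l) < e) ->
  0 <= r0 -> l <= X r0 ->
  exists r1, 0 <= r1 /\ (r1 = r0 \/ l < X r1) /\ X r0 <= X r1 /\ forall r, 0 <= r -> X r <= X r1.
Proof.
intros Hc Hl Hr0 H0.
destruct (classic (forall r, 0 <= r -> X r <= X r0)) as [M|M].
{ exists r0; repeat split; auto; lra. }
apply not_all_ex_not in M. destruct M as [r2 M].
apply imply_to_and in M. destruct M as [Hr2 M]. apply Rnot_le_lt in M.
destruct (Hl (X r2 - l)) as [N HN]; [lra|].
destruct (continuity_ab_maj X 0 (Rmax r2 N)) as [r1 [H1 Hr1]].
- apply Rle_trans with (1 := Hr2), Rmax_l.
- intros r _. apply continuity_pt_filterlim, Hc.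
- assert (X r2 <= X r1) by (apply H1; split; [easy|apply Rmax_l]).
  exists r1; repeat split; try lra. intros r Hr.
  destruct (Rle_lt_dec r (Rmax r2 N)) as [|L]; [apply H1; lra|].
  assert (Rabs (X r - l) < X r2 - l).
  { apply HN. generalize (Rmax_r r2 N); lra. }
  apply Rabs_def2 in H2. lra.
Qed.

(** * Continuity tools and radial equations near the origin *)

Lemma continuous_add {T : UniformSpace} (f g : T -> R) (x : T) :
  continuous f x -> continuous g x -> continuous (fun t => f t + g t) x.
Proof. exact (continuous_plus f g x). Qed.

Lemma continuous_sub {T : UniformSpace} (f g : T -> R) (x : T) :
  continuous f x -> continuous g x -> continuous (fun t => f t - g t) x.
Proof. exact (continuous_minus f g x). Qed.

Lemma continuous_neg {T : UniformSpace} (f : T -> R) (x : T) :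
  continuous f x -> continuous (fun t => - f t) x.
Proof. exact (continuous_opp f x). Qed.

Lemma continuous_mul {T : UniformSpace} (f g : T -> R) (x : T) :
  continuous f x -> continuous g x -> continuous (fun t => f t * g t) x.
Proof. exact (continuous_mult f g x). Qed.

Ltac continuous_poly := unfold Rdiv; cbn [pow];
  repeat lazymatch goal with
  | |- continuous (fun t => @?a t + @?b t) ?x => apply (continuous_add a b x)
  | |- continuous (fun t => @?a t - @?b t) ?x => apply (continuous_sub a b x)
  | |- continuous (fun t => @?a t * @?b t) ?x => apply (continuous_mul a b x)
  | |- continuous (fun t => - @?a t) ?x => apply (continuous_neg a x)
  | |- continuous (fun _ => ?c) ?x => apply (continuous_const c x)
  | |- _ => assumption
  end.

Lemma continuous_eps (f : R -> R) (x e : R) : continuous f x -> 0 < e ->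
  exists d, 0 < d /\ forall t, Rabs (t - x) < d -> Rabs (f t - f x) < e.
Proof.
intros H He. apply (proj1 (filterlim_locally f (f x))) with (eps := mkposreal e He) in H.
destruct H as [d Hd]. exists d; split; [apply cond_pos|]. intros t Ht. apply Hd, Ht.
Qed.

Lemma is_derive_mul (f g : R -> R) (x df dg : R) :
  is_derive f x df -> is_derive g x dg ->
  is_derive (fun t => f t * g t) x (df * g x + f x * dg).
Proof. intros Hf Hg. exact (is_derive_mult f g x df dg Hf Hg Rmult_comm). Qed.

Lemma Derive_eta (Z : R -> R) (x d : R) : is_derive Z x d -> Derive (fun t : R => Z t) x = d.
Proof. exact (is_derive_unique Z x d). Qed.

(** The equation says (r q)' = r G, so [r q] increases; since it tends to 0 at the origin, [q] is
    positive. *)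
Lemma radial_increase (Y q G : R -> R) (y0 d : R) :
  (forall r, 0 < r < d -> is_derive Y r (q r)) ->
  (forall r, 0 < r < d -> is_derive q r (- q r / r + G r)) ->
  (forall e, 0 < e -> exists d', 0 < d' /\ forall r, 0 < r < d' -> Rabs (q r) < e) ->
  (forall e, 0 < e -> exists d', 0 < d' /\ forall r, 0 < r < d' -> Rabs (Y r - y0) < e) ->
  (forall r, 0 < r < d -> 0 < G r) ->
  forall r, 0 < r < d -> y0 < Y r.
Proof.
intros HY Hq Lq LY HG.
assert (Hphi : forall a b, 0 < a -> a < b -> b < d -> a * q a < b * q b).
{ intros a b Ha Hab Hb.
  destruct (is_derive_MVT (fun r => r * q r) (fun r => r * G r) a b) as [c [Hc E]]; [easy| |].
  - intros t Ht. evar_last.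
    + apply (is_derive_mul (fun r => r) q); [apply (is_derive_id (K := R_AbsRing))|apply Hq; lra].
    + unfold one; simpl. field; lra.
  - assert (0 < c * G c * (b - a)); [|lra].
    specialize (HG c). apply Rmult_lt_0_compat; [apply Rmult_lt_0_compat; lra|lra]. }
assert (Hpos : forall r, 0 < r < d -> 0 < q r).
{ intros r Hr. apply Rnot_le_lt. intros N.
  assert (H1 : r / 2 * q (r / 2) < r * q r) by (apply Hphi; lra).
  assert (H2 : r * q r <= 0) by nra.
  (* The product t q(t) stays below [- c] for all t < r/2, while |q| < 1 near 0 gives |t q(t)| < t,
     and t is taken at most [c]. *)
  set (c := - (r / 2 * q (r / 2))). assert (Hc : 0 < c) by (unfold c; lra).
  destruct (Lq 1 Rlt_0_1) as [d' [Hd' H]].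
  set (t := Rmin (r / 4) (Rmin (d' / 2) c)).
  assert (0 < t) by (repeat apply Rmin_glb_lt; lra).
  assert (T1 := Rmin_l (r / 4) (Rmin (d' / 2) c)). assert (T2 := Rmin_r (r / 4) (Rmin (d' / 2) c)).
  assert (T3 := Rmin_l (d' / 2) c). assert (T4 := Rmin_r (d' / 2) c). fold t in T1, T2.
  assert (H3 : t * q t < - c) by (unfold c; rewrite Ropp_involutive; apply Hphi; lra).
  assert (H4 : Rabs (q t) < 1) by (apply H; lra).
  apply Rabs_def2 in H4. nra. }
assert (Hinc : forall a b, 0 < a -> a < b -> b < d -> Y a < Y b).
{ intros a b Ha Hab Hb.
  destruct (is_derive_MVT Y q a b) as [c [Hc E]]; [easy|intros t Ht; apply HY; lra|].
  assert (0 < q c) by (apply Hpos; lra). nra. }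
intros r Hr. apply Rnot_le_lt. intros N.
assert (H1 : Y (r / 2) < Y r) by (apply Hinc; lra).
destruct (LY (y0 - Y (r / 2))) as [d' [Hd' H]]; [lra|].
set (t := Rmin (r / 4) (d' / 2)).
assert (0 < t) by (apply Rmin_glb_lt; lra).
assert (T1 := Rmin_l (r / 4) (d' / 2)). assert (T2 := Rmin_r (r / 4) (d' / 2)). fold t in T1, T2.
assert (H2 : Y t < Y (r / 2)) by (apply Hinc; lra).
assert (H3 := H t ltac:(lra)). apply Rabs_def2 in H3. lra.
Qed.

Lemma radial_decrease (Y q G : R -> R) (y0 d : R) :
  (forall r, 0 < r < d -> is_derive Y r (q r)) ->
  (forall r, 0 < r < d -> is_derive q r (- q r / r + G r)) ->
  (forall e, 0 < e -> exists d', 0 < d' /\ forall r, 0 < r < d' -> Rabs (q r) < e) ->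
  (forall e, 0 < e -> exists d', 0 < d' /\ forall r, 0 < r < d' -> Rabs (Y r - y0) < e) ->
  (forall r, 0 < r < d -> G r < 0) ->
  forall r, 0 < r < d -> Y r < y0.
Proof.
intros HY Hq Lq LY HG r Hr. apply Ropp_lt_cancel.
apply (radial_increase (fun r => - Y r) (fun r => - q r) (fun r => - G r) (- y0) d); try easy.
- intros t Ht. apply (is_derive_opp Y), HY, Ht.
- intros t Ht. evar_last; [apply (is_derive_opp q), Hq, Ht|].
  unfold opp; simpl. field; lra.
- intros e He. destruct (Lq e He) as [d' [Hd' H]]. exists d'; split; [easy|].
  intros t Ht. rewrite Rabs_Ropp. now apply H.
- intros e He. destruct (LY e He) as [d' [Hd' H]]. exists d'; split; [easy|].
  intros t Ht. replace (- Y t - - y0) with (- (Y t - y0)) by ring. rewrite Rabs_Ropp. now apply H.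
- intros t Ht. specialize (HG t Ht). lra.
Qed.

(** * The rescaled system *)

(** Here al = a^2, be = e b^2 and ga = c^2. The mixed derivatives are f_y = x (ga y - be) / 3 and
    g_x = x (ga y - be): for x > 0 the system is cooperative exactly where ga y <= be. *)
Definition f_rhs (al be ga x y : R) : R :=
  x * (- al - be * y / 3 + ga * (x ^ 2 / 2 + y ^ 2 / 6)).

Definition g_rhs (al be ga x y : R) : R :=
  y * (- al + be * y / 6 + ga * (x ^ 2 / 2 + y ^ 2 / 6)) - be * x ^ 2 / 2.

(** With w = ga y, the coefficient w - be of x^2 is nonnegative and (w^2 + be w) / 6 is at least
    be^2 / 3, which exceeds al ga. This excludes maxima of [Y] in the range that is not
    cooperative. *)
Lemma g_pos_pos al be ga x y : 0 < ga -> 0 < be -> 3 * al * ga < be ^ 2 -> be <= ga * y ->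
  0 < g_rhs al be ga x y.
Proof.
intros Hga Hb Hal Hy. set (w := ga * y).
assert (E : ga ^ 2 * g_rhs al be ga x y =
  ga ^ 2 * ((w - be) * x ^ 2 / 2) + w * ((w ^ 2 + be * w) / 6 - al * ga))
  by (unfold g_rhs, w; field).
assert (Hw : be <= w) by easy.
assert (be ^ 2 <= w ^ 2) by (apply pow_incr; lra).
assert (be * be <= be * w) by (apply Rmult_le_compat_l; lra).
assert (0 < w * ((w ^ 2 + be * w) / 6 - al * ga)) by (apply Rmult_lt_0_compat; lra).
assert (0 <= (w - be) * x ^ 2) by (apply Rmult_le_pos; [lra|apply pow2_ge_0]).
assert (Hga2 : 0 < ga ^ 2) by now apply pow_lt.
assert (0 <= ga ^ 2 * ((w - be) * x ^ 2 / 2)) by (apply Rmult_le_pos; lra).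
apply (Rmult_lt_reg_l (ga ^ 2)); [easy|]. lra.
Qed.

(** Counterpart for be < 0: now be <= w < 0 bounds (w^2 + be w) / 6 above by be^2 / 3 < al ga, and
    the prefactor is - w > 0. *)
Lemma g_pos_neg al be ga x y : 0 < ga -> be < 0 -> be ^ 2 < 3 * al * ga -> y < 0 ->
  be <= ga * y -> 0 < g_rhs al be ga x y.
Proof.
intros Hga Hb Hal Hy0 Hy. set (w := ga * y).
assert (E : ga ^ 2 * g_rhs al be ga x y =
  ga ^ 2 * ((w - be) * x ^ 2 / 2) + (- w) * (al * ga - (w ^ 2 + be * w) / 6))
  by (unfold g_rhs, w; field).
assert (Hw : be <= w) by easy.
assert (Hw0 : 0 < - w).
{ replace (- w) with (ga * - y) by (unfold w; ring). apply Rmult_lt_0_compat; lra. }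
assert ((- w) ^ 2 <= (- be) ^ 2) by (apply pow_incr; lra).
assert ((- be) * (- w) <= (- be) * (- be)) by (apply Rmult_le_compat_l; lra).
assert (0 < (- w) * (al * ga - (w ^ 2 + be * w) / 6)) by (apply Rmult_lt_0_compat; lra).
assert (0 <= (w - be) * x ^ 2) by (apply Rmult_le_pos; [lra|apply pow2_ge_0]).
assert (Hga2 : 0 < ga ^ 2) by now apply pow_lt.
assert (0 <= ga ^ 2 * ((w - be) * x ^ 2 / 2)) by (apply Rmult_le_pos; lra).
apply (Rmult_lt_reg_l (ga ^ 2)); [easy|]. lra.
Qed.

(* The pair (X, Y) is extended by constants outside the interval of existence D. *)
Record profile (al be ga K s m y0 : R) (D : R -> Prop) (X p Y q : R -> R) : Prop := {
  ga_pos : 0 < ga;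
  K_pos : 0 < K;
  s_pos : 0 < s;
  m_sqr : m ^ 2 = s ^ 2;
  al_eq : al = 2 / 3 * ga * s ^ 2 - be * m / 3;
  D_interval : (exists Re, 0 < Re /\ forall r, D r <-> 0 < r < Re) \/ forall r, D r <-> 0 < r;
  X_cont : forall r, continuous X r;
  Y_cont : forall r, continuous Y r;
  X_lim : forall e, 0 < e -> exists N, forall r, N <= r -> Rabs (X r - s) < e;
  Y_lim : forall e, 0 < e -> exists N, forall r, N <= r -> Rabs (Y r - m) < e;
  X_left : forall r, r <= 0 -> X r = 0;
  Y_left : forall r, r <= 0 -> Y r = y0;
  X_right : forall r, 0 < r -> ~ D r -> X r = s;
  Y_right : forall r, 0 < r -> ~ D r -> Y r = m;
  X_pos : forall r, D r -> 0 < X r;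
  X_der : forall r, D r -> is_derive X r (p r);
  p_der : forall r, D r -> is_derive p r (- p r / r + K * X r / r ^ 2 + f_rhs al be ga (X r) (Y r));
  Y_der : forall r, D r -> is_derive Y r (q r);
  q_der : forall r, D r -> is_derive q r (- q r / r + g_rhs al be ga (X r) (Y r));
  q_lim : forall e, 0 < e -> exists d, 0 < d /\ forall r, 0 < r < d -> Rabs (q r) < e
}.

Arguments ga_pos {_ _ _ _ _ _ _ _ _ _ _ _}.
Arguments K_pos {_ _ _ _ _ _ _ _ _ _ _ _}.
Arguments s_pos {_ _ _ _ _ _ _ _ _ _ _ _}.
Arguments m_sqr {_ _ _ _ _ _ _ _ _ _ _ _}.
Arguments al_eq {_ _ _ _ _ _ _ _ _ _ _ _}.
Arguments D_interval {_ _ _ _ _ _ _ _ _ _ _ _}.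
Arguments X_cont {_ _ _ _ _ _ _ _ _ _ _ _}.
Arguments Y_cont {_ _ _ _ _ _ _ _ _ _ _ _}.
Arguments X_lim {_ _ _ _ _ _ _ _ _ _ _ _}.
Arguments Y_lim {_ _ _ _ _ _ _ _ _ _ _ _}.
Arguments X_left {_ _ _ _ _ _ _ _ _ _ _ _}.
Arguments Y_left {_ _ _ _ _ _ _ _ _ _ _ _}.
Arguments X_right {_ _ _ _ _ _ _ _ _ _ _ _}.
Arguments Y_right {_ _ _ _ _ _ _ _ _ _ _ _}.
Arguments X_pos {_ _ _ _ _ _ _ _ _ _ _ _}.
Arguments X_der {_ _ _ _ _ _ _ _ _ _ _ _}.
Arguments p_der {_ _ _ _ _ _ _ _ _ _ _ _}.
Arguments Y_der {_ _ _ _ _ _ _ _ _ _ _ _}.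
Arguments q_der {_ _ _ _ _ _ _ _ _ _ _ _}.
Arguments q_lim {_ _ _ _ _ _ _ _ _ _ _ _}.

Section Profile.
Variables (al be ga K s m y0 : R) (D : R -> Prop) (X p Y q : R -> R).
Hypothesis HP : profile al be ga K s m y0 D X p Y q.

Let f := f_rhs al be ga.
Let g := g_rhs al be ga.

Lemma D_pos r : D r -> 0 < r.
Proof. destruct (D_interval HP) as [[Re [_ H]]|H]; rewrite H; lra. Qed.

Lemma D_down r r' : D r -> 0 < r' <= r -> D r'.
Proof. destruct (D_interval HP) as [[Re [_ H]]|H]; rewrite !H; lra. Qed.

Lemma D_nbhd r : D r -> exists e, 0 < e /\ e <= r /\ forall t, r - e < t < r + e -> D t.
Proof.
intros Hr. assert (Hr0 := D_pos r Hr).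
assert (H : exists e, 0 < e /\ D (r + e)).
{ destruct (D_interval HP) as [[Re [_ H]]|H]; rewrite H in Hr.
  - exists ((Re - r) / 2). rewrite H. lra.
  - exists 1. rewrite H. lra. }
destruct H as [e [He H]]. exists (Rmin e r). assert (H1 := Rmin_l e r). assert (H2 := Rmin_r e r).
repeat split; [apply Rmin_glb_lt; lra|lra|].
intros t Ht. apply (D_down (r + e)); [easy|lra].
Qed.

Lemma D_near_0 : exists d, 0 < d /\ forall r, 0 < r < d -> D r.
Proof.
destruct (D_interval HP) as [[Re [HR H]]|H].
- exists Re; split; [easy|]. intros r Hr. now apply H.
- exists 1; split; [lra|]. intros r Hr. apply H; lra.
Qed.

Lemma Y_0 : Y 0 = y0.
Proof. apply (Y_left HP); lra. Qed.

Lemma X_0 : X 0 = 0.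
Proof. apply (X_left HP); lra. Qed.

Lemma Y_near_0 e : 0 < e -> exists d, 0 < d /\ forall r, 0 < r < d -> Rabs (Y r - y0) < e.
Proof.
intros He. destruct (continuous_eps Y 0 e) as [d [Hd H]]; [apply (Y_cont HP)|easy|].
exists d; split; [easy|]. intros r Hr. rewrite <- Y_0. apply H.
rewrite Rminus_0_r, Rabs_pos_eq; lra.
Qed.

Lemma Y_increase_near_0 d : (forall r, 0 < r < d -> D r) ->
  (forall r, 0 < r < d -> 0 < g (X r) (Y r)) -> forall r, 0 < r < d -> y0 < Y r.
Proof.
intros HD Hg. apply (radial_increase Y q (fun r => g (X r) (Y r)) y0 d); try easy.
- intros r Hr. apply (Y_der HP), HD, Hr.
- intros r Hr. apply (q_der HP), HD, Hr.
- apply (q_lim HP).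
- exact Y_near_0.
Qed.

Lemma Y_decrease_near_0 d : (forall r, 0 < r < d -> D r) ->
  (forall r, 0 < r < d -> g (X r) (Y r) < 0) -> forall r, 0 < r < d -> Y r < y0.
Proof.
intros HD Hg. apply (radial_decrease Y q (fun r => g (X r) (Y r)) y0 d); try easy.
- intros r Hr. apply (Y_der HP), HD, Hr.
- intros r Hr. apply (q_der HP), HD, Hr.
- apply (q_lim HP).
- exact Y_near_0.
Qed.

Lemma g_continuous r : continuous (fun t => g (X t) (Y t)) r.
Proof.
assert (HX := X_cont HP r).
assert (HY := Y_cont HP r).
unfold g, g_rhs. continuous_poly.
Qed.

Lemma D_below_limit r : 0 <= r -> Y r <> m -> r = 0 \/ D r.
Proof.
intros Hr Hm. destruct (Rle_lt_or_eq_dec 0 r Hr) as [H|H]; [right|now left].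
apply NNPP; intros N. apply Hm, (Y_right HP r H N).
Qed.

Lemma radial_local_min (Z Z1 G : R -> R) r e :
  (forall t, D t -> is_derive Z t (Z1 t)) ->
  (forall t, D t -> is_derive Z1 t (- Z1 t / t + G t)) ->
  D r -> 0 < e -> (forall t, r - e < t < r + e -> Z r <= Z t) -> 0 <= G r.
Proof.
intros HZ HZ1 Hr He0 M.
destruct (D_nbhd r Hr) as [e1 [He1 [_ HD]]].
assert (L1 := Rmin_l e e1). assert (L2 := Rmin_r e e1).
assert (He : 0 < Rmin e e1) by (apply Rmin_glb_lt; lra).
assert (E : Z1 r = 0).
{ apply Rle_antisym.
  - apply (left_min_derive_le0 Z r _ e (HZ r Hr) He0). intros t Ht. apply M; lra.
  - apply (right_min_derive_ge0 Z r _ e (HZ r Hr) He0). intros t Ht. apply M; lra. }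
assert (H : 0 <= - Z1 r / r + G r).
{ apply (second_derive_right_min Z Z1 r _ (Rmin e e1) He); [|easy|apply (HZ1 r Hr)|].
  - intros t Ht. apply HZ, HD; lra.
  - intros t Ht. apply M; lra. }
rewrite E in H. unfold Rdiv in H. lra.
Qed.

Lemma radial_local_max (Z Z1 G : R -> R) r e :
  (forall t, D t -> is_derive Z t (Z1 t)) ->
  (forall t, D t -> is_derive Z1 t (- Z1 t / t + G t)) ->
  D r -> 0 < e -> (forall t, r - e < t < r + e -> Z t <= Z r) -> G r <= 0.
Proof.
intros HZ HZ1 Hr He M.
assert (H : 0 <= - G r); [|lra].
apply (radial_local_min (fun t => - Z t) (fun t => - Z1 t) (fun t => - G t) r e); try easy.
- intros t Ht. apply (is_derive_opp Z), HZ, Ht.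
- intros t Ht. replace (- - Z1 t / t + - G t) with (- (- Z1 t / t + G t)) by (unfold Rdiv; ring).
  apply (is_derive_opp Z1), HZ1, Ht.
- intros t Ht. specialize (M t Ht). lra.
Qed.

Lemma p_der' r : D r ->
  is_derive p r (- p r / r + (K * X r / r ^ 2 + f (X r) (Y r))).
Proof. intros Hr. rewrite <- Rplus_assoc. apply (p_der HP r Hr). Qed.

Lemma g_at_max r : r = 0 \/ D r -> (forall t, 0 <= t -> Y t <= Y r) -> g (X r) (Y r) <= 0.
Proof.
intros [Hr|Hr] M.
- apply Rnot_lt_le; intros N. subst r.
  destruct (continuous_eps _ 0 _ (g_continuous 0) N) as [d [Hd H]].
  destruct D_near_0 as [d' [Hd' HD]].
  assert (L1 := Rmin_l d d'). assert (L2 := Rmin_r d d').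
  assert (L0 : 0 < Rmin d d') by (apply Rmin_glb_lt; lra).
  assert (y0 < Y (Rmin d d' / 2)).
  { apply (Y_increase_near_0 (Rmin d d')); [intros t Ht; apply HD; lra| |lra].
    intros t Ht. assert (Ht' : Rabs (t - 0) < d) by (rewrite Rminus_0_r, Rabs_pos_eq; lra).
    specialize (H t Ht'). apply Rabs_def2 in H. lra. }
  specialize (M (Rmin d d' / 2) ltac:(lra)). rewrite Y_0 in M. lra.
- assert (H0 := D_pos r Hr).
  apply (radial_local_max Y q (fun t => g (X t) (Y t)) r r (Y_der HP) (q_der HP) Hr H0).
  intros t Ht. apply M; lra.
Qed.

(** After division by [X r > 0], the positive term [K / r^2] makes the bound strict. *)
Lemma X_max_bound r e : D r -> 0 < e -> (forall t, r - e < t < r + e -> X t <= X r) ->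
  ga * X r ^ 2 / 2 < al + be * Y r / 3 - ga * Y r ^ 2 / 6.
Proof.
intros Hr He M.
assert (H := radial_local_max X p _ r e (X_der HP) p_der' Hr He M). cbv beta in H.
assert (Hx := X_pos HP r Hr).
assert (H0 := D_pos r Hr).
assert (HK := K_pos HP).
assert (HKr : 0 < K / r ^ 2) by (apply Rdiv_lt_0_compat; [easy|now apply pow_lt]).
unfold f, f_rhs in H.
replace (K * X r / r ^ 2) with (X r * (K / r ^ 2)) in H by (unfold Rdiv; ring).
rewrite <- Rmult_plus_distr_l in H.
assert (K / r ^ 2 + (- al - be * Y r / 3 + ga * (X r ^ 2 / 2 + Y r ^ 2 / 6)) <= 0); [|lra].
apply Rnot_lt_le; intros N. apply (Rlt_irrefl 0).
apply Rlt_le_trans with (2 := H). now apply Rmult_lt_0_compat.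
Qed.

Lemma X_nonneg r : 0 <= r -> 0 <= X r.
Proof.
intros Hr. destruct (Rle_lt_or_eq_dec 0 r Hr) as [H|H].
- destruct (classic (D r)) as [HD|HD].
  + apply Rlt_le, (X_pos HP r HD).
  + rewrite (X_right HP r H HD). apply Rlt_le, (s_pos HP).
- subst r. rewrite X_0; lra.
Qed.

(** This is the third derivative of [X] at a critical point: the f_x term vanishes with [p r], and
    only the coupling through [q] and the derivative of [K / r^2] remain. *)
Lemma p_critical_derive r : D r -> p r = 0 ->
  is_derive (fun t => - p t / t + (K * X t / t ^ 2 + f (X t) (Y t))) r
    (- (- p r / r + (K * X r / r ^ 2 + f (X r) (Y r))) / r - 2 * K * X r / r ^ 3
     + X r * q r * (ga * Y r - be) / 3).
Proof.
intros Hr Hp. assert (H0 := D_pos r Hr).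
assert (Hd := p_der' r Hr). assert (HX := X_der HP r Hr). assert (HY := Y_der HP r Hr).
unfold f, f_rhs in *.
auto_derive.
- repeat split; try nra; eexists; eassumption.
- rewrite (Derive_eta _ _ _ Hd), (Derive_eta _ _ _ HX), (Derive_eta _ _ _ HY), Hp.
  field. lra.
Qed.

Lemma q_critical_derive r : D r -> q r = 0 ->
  is_derive (fun t => - q t / t + g (X t) (Y t)) r
    (- (- q r / r + g (X r) (Y r)) / r + X r * p r * (ga * Y r - be)).
Proof.
intros Hr Hp. assert (H0 := D_pos r Hr).
assert (Hd := q_der HP r Hr). assert (HX := X_der HP r Hr). assert (HY := Y_der HP r Hr).
unfold g, g_rhs in *.
auto_derive.
- repeat split; try lra; eexists; eassumption.
- rewrite (Derive_eta _ _ _ Hd), (Derive_eta _ _ _ HX), (Derive_eta _ _ _ HY), Hp.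
  field. lra.
Qed.

(* At a zero of p where X is increasing to the right, p' >= 0 and symmetric comparison gives
   p'' >= 0, whereas the differentiated equation has the negative source -2KX/r^3. *)
Lemma p_pos_of_symmetric r e : D r -> 0 < e ->
  (forall t, 0 < t < e -> X (r - t) <= X (r + t)) ->
  (forall t, 0 <= t < e -> 0 <= p (r + t)) -> 0 <= q r -> ga * Y r <= be -> 0 < p r.
Proof.
intros Hr He0 S P Hq Hy. assert (H0 := D_pos r Hr).
assert (P0 : 0 <= p r) by (rewrite <- (Rplus_0_r r); apply P; lra).
destruct (Rle_lt_or_eq_dec _ _ P0) as [|E]; [easy|exfalso].
assert (Z : p r = 0) by easy.
destruct (D_nbhd r Hr) as [e1 [He1 [_ HD]]].
assert (L1 := Rmin_l e e1). assert (L2 := Rmin_r e e1).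
assert (He : 0 < Rmin e e1) by (apply Rmin_glb_lt; lra).
assert (H1 : 0 <= - p r / r + (K * X r / r ^ 2 + f (X r) (Y r))).
{ apply (right_min_derive_ge0 p r _ e); [apply p_der', Hr|easy|].
  intros t Ht. rewrite Z. apply P; lra. }
assert (H2 := symmetric_third_derive X p _ r _ _ He
  (fun t Ht => X_der HP t (HD t ltac:(lra))) (fun t Ht => p_der' t (HD t ltac:(lra)))
  (p_critical_derive r Hr Z) Z (fun t Ht => S t ltac:(lra))).
set (p' := - p r / r + (K * X r / r ^ 2 + f (X r) (Y r))) in *.
assert (HX := X_pos HP r Hr).
assert (0 <= p' / r) by (apply Rdiv_le_0_compat; lra).
assert (0 < 2 * K * X r / r ^ 3).
{ apply Rdiv_lt_0_compat; [|now apply pow_lt].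
  assert (HK := K_pos HP). apply Rmult_lt_0_compat; lra. }
assert (0 <= X r * q r * (be - ga * Y r)).
{ apply Rmult_le_pos; [apply Rmult_le_pos|]; lra. }
unfold Rdiv in *. lra.
Qed.

Lemma near_end M e : D M -> 0 < e -> exists N, M <= N /\ D N /\
  forall r, N <= r -> Rabs (X r - s) < e /\ Rabs (Y r - m) < e.
Proof.
intros HM He. assert (H0 := D_pos M HM).
destruct (D_interval HP) as [[Re [HR H]]|H].
- assert (HRe : ~ D Re) by (rewrite H; lra).
  assert (EX : forall r, Re <= r -> X r = s).
  { intros r Hr. apply (X_right HP); [lra|rewrite H; lra]. }
  assert (EY : forall r, Re <= r -> Y r = m).
  { intros r Hr. apply (Y_right HP); [lra|rewrite H; lra]. }
  destruct (continuous_eps X Re e (X_cont HP Re) He) as [e1 [He1 H1]].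
  destruct (continuous_eps Y Re e (Y_cont HP Re) He) as [e2 [He2 H2]].
  rewrite EX in H1 by lra. rewrite EY in H2 by lra.
  apply H in HM.
  set (N := Rmax M (Re - Rmin e1 e2 / 2)).
  assert (L1 := Rmin_l e1 e2). assert (L2 := Rmin_r e1 e2).
  assert (0 < Rmin e1 e2) by (apply Rmin_glb_lt; lra).
  assert (L3 := Rmax_l M (Re - Rmin e1 e2 / 2)).
  assert (L4 := Rmax_r M (Re - Rmin e1 e2 / 2)). fold N in L3, L4.
  exists N. split; [easy|]. split.
  + apply H. split; [lra|]. unfold N. apply Rmax_lub_lt; lra.
  + intros r Hr. destruct (Rle_lt_dec Re r) as [L|L].
    * rewrite EX, EY, !Rminus_diag, Rabs_R0 by easy. easy.
    * split; [apply H1|apply H2]; apply Rabs_def1; lra.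
- destruct (X_lim HP e He) as [N1 H1]. destruct (Y_lim HP e He) as [N2 H2].
  exists (Rmax M (Rmax N1 N2)).
  assert (L1 := Rmax_l M (Rmax N1 N2)). assert (L2 := Rmax_r M (Rmax N1 N2)).
  assert (L3 := Rmax_l N1 N2). assert (L4 := Rmax_r N1 N2).
  split; [easy|]. split; [apply H; lra|]. intros r Hr. split; [apply H1|apply H2]; lra.
Qed.

(** The limit of negative values could be 0. In that case ga Y >= be near the origin, where g > 0,
    so [Y] would rise above y0 >= 0. *)
Lemma Y_0_neg : be < 0 -> be ^ 2 < 3 * al * ga -> (forall r, D r -> Y r < 0) -> y0 < 0.
Proof.
intros Hb Hal HY. assert (Hga := ga_pos HP). apply Rnot_le_lt; intros N.
destruct (Y_near_0 (- be / ga)) as [d [Hd H]]; [apply Rdiv_lt_0_compat; lra|].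
destruct D_near_0 as [d' [Hd' HD]].
assert (L1 := Rmin_l d d'). assert (L2 := Rmin_r d d').
assert (L0 : 0 < Rmin d d') by (apply Rmin_glb_lt; lra).
assert (H1 : y0 < Y (Rmin d d' / 2)); [|specialize (HY (Rmin d d' / 2) (HD (Rmin d d' / 2) ltac:(lra))); lra].
apply (Y_increase_near_0 (Rmin d d')); [intros t Ht; apply HD; lra| |lra].
intros t Ht. assert (Hy := HY t (HD t ltac:(lra))).
assert (H1 := H t ltac:(lra)). apply Rabs_def2 in H1.
apply g_pos_neg; try easy.
assert (H2 : ga * (be / ga) <= ga * Y t) by (apply Rmult_le_compat_l; lra).
replace (ga * (be / ga)) with be in H2 by (field; lra). lra.
Qed.

(** * The cooperative case *)

Section Cooperative.

(** * Structural hypotheses and a priori bounds *)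

Hypothesis be_gt : ga * m < be.
Hypothesis g_pos_above :
  forall r x, r = 0 \/ D r -> be <= ga * Y r -> 0 < g_rhs al be ga x (Y r).
(** The right-hand side has two meanings: it is be times the cofactor left when the quadratic of
    [g_max_algebra] is divided by y - m, and at y = m, multiplied by s^2 / 3, it is the determinant
    of the linearization at (s, m). *)
Hypothesis stab : forall y, m <= y -> ga * y < be -> 0 < be * (2 * ga * (y + m) - be).

(** The bound of [X_max_bound] at a maximum of [X] is an increasing function of y as long as ga y <=
    be, so it may be evaluated at [y1]. At y = m it equals ga s^2 / 2, which settles the case where
    [X] does not exceed its limit. *)
Lemma X_bound_of_Y_bound y1 : (forall r, 0 <= r -> Y r <= y1) -> m <= y1 -> ga * y1 < be ->
  forall r, 0 <= r -> ga * X r ^ 2 / 2 <= al + be * y1 / 3 - ga * y1 ^ 2 / 6.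
Proof.
intros M Hm H1 r Hr.
assert (Hga := ga_pos HP). assert (Hs := s_pos HP). assert (Hms := m_sqr HP).
assert (Hal := al_eq HP).
assert (T : forall y, y <= y1 ->
  al + be * y / 3 - ga * y ^ 2 / 6 <= al + be * y1 / 3 - ga * y1 ^ 2 / 6).
{ intros y Hy. assert (0 <= (y1 - y) * (be / 3 - ga * (y1 + y) / 6)); [|nra].
  apply Rmult_le_pos; [lra|]. assert (ga * y <= ga * y1) by (apply Rmult_le_compat_l; lra). nra. }
assert (Sq : forall a b, 0 <= a -> a <= b -> ga * a ^ 2 / 2 <= ga * b ^ 2 / 2).
{ intros a b Ha Hab. assert (a ^ 2 <= b ^ 2) by (apply pow_incr; lra). nra. }
destruct (Rle_lt_dec (X r) s) as [L|L].
- apply Rle_trans with (ga * s ^ 2 / 2); [apply Sq; [now apply X_nonneg|easy]|].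
  apply Rle_trans with (2 := T m Hm). rewrite Hal, Hms. lra.
- destruct (max_of_limit_le X s r (X_cont HP) (X_lim HP) Hr) as [r1 [Hr1 [_ [L1 H]]]]; [lra|].
  assert (HD : D r1).
  { apply NNPP; intros N. destruct (Rle_lt_or_eq_dec 0 r1 Hr1) as [H0|H0].
    - rewrite (X_right HP r1 H0 N) in L1. lra.
    - subst r1. rewrite X_0 in L1. lra. }
  assert (H0 := D_pos r1 HD).
  apply Rle_trans with (ga * X r1 ^ 2 / 2); [apply Sq; [now apply X_nonneg|easy]|].
  apply Rle_trans with (2 := T (Y r1) (M r1 Hr1)).
  apply Rlt_le, (X_max_bound r1 r1); [easy|easy|]. intros t Ht. apply H; lra.
Qed.

Lemma g_max_algebra x y1 : m <= y1 -> ga * y1 < be ->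
  ga * x ^ 2 / 2 <= al + be * y1 / 3 - ga * y1 ^ 2 / 6 -> g x y1 <= 0 -> y1 = m.
Proof.
intros Hm H1 Hx Hg. assert (Hga := ga_pos HP).
assert (Hal := al_eq HP). assert (Hms := m_sqr HP).
(* The coefficient of x^2 in [g] is negative, so x^2 may be replaced by its upper bound; the cubic
   terms in y1 then cancel. *)
assert (A : be * (2 * ga * y1 ^ 2 - be * y1 - 3 * al) <= 0).
{ assert (H2 : 0 <= (be - ga * y1) * (al + be * y1 / 3 - ga * y1 ^ 2 / 6 - ga * x ^ 2 / 2))
    by (apply Rmult_le_pos; lra).
  assert (H3 : ga * g x y1 <= 0) by nra.
  unfold g, g_rhs in H3. nra. }
(* By [al_eq] and [m_sqr], 3 al = 2 ga m^2 - be m, so m is a root of the quadratic. *)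
assert (B : (y1 - m) * (be * (2 * ga * (y1 + m) - be)) <= 0).
{ rewrite Hal, <- Hms in A. nra. }
assert (C := stab y1 Hm H1).
destruct (Rle_lt_or_eq_dec m y1 Hm) as [L|]; [|easy].
assert (0 < (y1 - m) * (be * (2 * ga * (y1 + m) - be))) by (apply Rmult_lt_0_compat; lra). lra.
Qed.

(** One statement for both bounds: a value above m contradicts the equality [Y r1 = m], and a value
    equal to m leaves a touching point at which [g] can be evaluated. *)
Lemma Y_max_ge_m r : 0 <= r -> m <= Y r -> r = 0 \/ D r -> 
  exists r1, (r1 = 0 \/ D r1) /\ Y r <= Y r1 /\ Y r1 = m /\
    ga * X r1 ^ 2 / 2 <= al + be * m / 3 - ga * m ^ 2 / 6 /\ g (X r1) m <= 0.
Proof.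
intros Hr Hm HD.
destruct (max_of_limit_le Y m r (Y_cont HP) (Y_lim HP) Hr Hm) as [r1 [Hr1 [E [L1 H]]]].
assert (HD1 : r1 = 0 \/ D r1).
{ destruct E as [E|E]; [now subst r1|]. apply D_below_limit; lra. }
assert (Hg := g_at_max r1 HD1 H).
assert (Hb : ga * Y r1 < be).
{ apply Rnot_le_lt; intros N. assert (H0 := g_pos_above r1 (X r1) HD1 N). unfold g in Hg. lra. }
assert (Hx := X_bound_of_Y_bound (Y r1) H ltac:(lra) Hb r1 Hr1).
assert (Em : Y r1 = m) by (apply (g_max_algebra (X r1)); try easy; lra).
exists r1. rewrite Em in *. auto.
Qed.

Lemma Y_le_m r : 0 <= r -> Y r <= m.
Proof.
intros Hr. apply Rnot_lt_le; intros N.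
destruct (Y_max_ge_m r) as [r1 [_ [H1 [H2 _]]]]; [easy|lra| |lra].
apply D_below_limit; lra.
Qed.

Lemma X_lt_s r : D r -> X r < s.
Proof.
intros Hr. apply Rnot_le_lt; intros N.
assert (H0 := D_pos r Hr).
destruct (max_of_limit_le X s r (X_cont HP) (X_lim HP) ltac:(lra) N) as [r1 [Hr1 [E [L1 H]]]].
assert (Hs := s_pos HP).
assert (HD : D r1).
{ destruct E as [E|E]; [now subst r1|].
  apply NNPP; intros HN. destruct (Rle_lt_or_eq_dec 0 r1 Hr1) as [H2|H2].
  - rewrite (X_right HP r1 H2 HN) in E. lra.
  - subst r1. rewrite X_0 in E. lra. }
assert (H2 := D_pos r1 HD).
assert (M := X_bound_of_Y_bound m Y_le_m (Rle_refl m) be_gt).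
assert (H3 : ga * X r1 ^ 2 / 2 < al + be * Y r1 / 3 - ga * Y r1 ^ 2 / 6).
{ apply (X_max_bound r1 r1); [easy|easy|]. intros t Ht. apply H; lra. }
assert (Hga := ga_pos HP). assert (Hal := al_eq HP). assert (Hms := m_sqr HP).
assert (HY := Y_le_m r1 Hr1).
assert (s ^ 2 <= X r1 ^ 2) by (apply pow_incr; lra).
assert (0 <= (m - Y r1) * (be / 3 - ga * (m + Y r1) / 6)).
{ apply Rmult_le_pos; [lra|]. assert (ga * Y r1 <= ga * m) by (apply Rmult_le_compat_l; lra). nra. }
nra.
Qed.

Lemma X_le_s r : 0 <= r -> X r <= s.
Proof.
intros Hr. destruct (classic (D r)) as [H|H]; [apply Rlt_le, X_lt_s, H|].
destruct (Rle_lt_or_eq_dec 0 r Hr) as [H2|H2].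
- rewrite (X_right HP r H2 H); lra.
- subst r; rewrite X_0. apply Rlt_le, (s_pos HP).
Qed.

(** At a touching point [g] equals (be - ga m)(s^2 - X^2) / 2, which is positive since X < s,
    against the sign at a maximum. The strict bound on [X] therefore comes first. *)
Lemma Y_lt_m r : r = 0 \/ D r -> Y r < m.
Proof.
intros HD. assert (Hr : 0 <= r).
{ destruct HD as [HD|HD]; [lra|apply Rlt_le, (D_pos r HD)]. }
apply Rnot_le_lt; intros N.
destruct (Y_max_ge_m r Hr N HD) as [r1 [HD1 [_ [_ [_ H]]]]].
assert (Hs := s_pos HP). assert (Hga := ga_pos HP).
assert (Hal := al_eq HP). assert (Hms := m_sqr HP).
assert (Hx : 0 <= X r1 < s).
{ destruct HD1 as [H1|H1]; [subst r1; rewrite X_0; lra|].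
  split; [apply Rlt_le, (X_pos HP r1 H1)|apply (X_lt_s r1 H1)]. }
assert (g (X r1) m = (be - ga * m) * (s ^ 2 - X r1 ^ 2) / 2).
{ unfold g, g_rhs. rewrite Hal, <- Hms. field. }
assert (X r1 ^ 2 < s ^ 2) by nra.
assert (0 < (be - ga * m) * (s ^ 2 - X r1 ^ 2)) by (apply Rmult_lt_0_compat; lra). lra.
Qed.

Lemma gaY_lt_be r : 0 <= r -> ga * Y r < be.
Proof.
intros Hr. assert (ga * Y r <= ga * m); [|lra].
apply Rmult_le_compat_l; [apply Rlt_le, (ga_pos HP)|now apply Y_le_m].
Qed.

(** * Ordered pairs and strictness *)

Definition ordered (lam : R) : Prop := forall sg rho, 0 <= sg -> sg < rho ->
  2 * lam <= rho + sg -> X sg <= X rho /\ Y sg <= Y rho.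

(** The radial Laplacian of Z is [G], and that of C - kap r^2 is -4 kap; the two sides of the
    contact together give 8 kap mu. With mu = 0 this yields strictness, with mu < 0 or > 0 it
    handles minimal quotients. *)
Lemma contact_quadratic (Z Z1 G : R -> R) (mu C kap rho sg e : R) :
  (forall r, D r -> is_derive Z r (Z1 r)) ->
  (forall r, D r -> is_derive Z1 r (- Z1 r / r + G r)) ->
  D rho -> 0 < sg < rho -> 0 < e ->
  Z rho + mu * (C - kap * rho ^ 2) = Z sg - mu * (C - kap * sg ^ 2) ->
  (forall r t, rho - e < r < rho + e -> sg - e < t < sg + e -> rho + sg <= r + t ->
    Z t - mu * (C - kap * t ^ 2) <= Z r + mu * (C - kap * r ^ 2)) ->
  G sg <= G rho - 8 * kap * mu.
Proof.
intros HZ HZ1 Hr Hs He E M.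
assert (Hsd : D sg) by (apply (D_down rho); [easy|lra]).
destruct (D_nbhd rho Hr) as [e1 [He1 [_ HD1]]].
destruct (D_nbhd sg Hsd) as [e2 [He2 [_ HD2]]].
set (d := Rmin e (Rmin e1 e2)).
assert (L1 := Rmin_l e (Rmin e1 e2)). assert (L2 := Rmin_r e (Rmin e1 e2)).
assert (L3 := Rmin_l e1 e2). assert (L4 := Rmin_r e1 e2). fold d in L1, L2.
assert (Hd : 0 < d) by (repeat apply Rmin_glb_lt; lra).
assert (Hp : forall t, is_derive (fun r => mu * (C - kap * r ^ 2)) t (- 2 * mu * kap * t)).
{ intros t. auto_derive; [easy|ring]. }
assert (Hp1 : forall t, is_derive (fun r => - 2 * mu * kap * r) t (- 2 * mu * kap)).
{ intros t. auto_derive; [easy|ring]. }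
assert (H := contact_radial_laplacian
  (fun r => Z r + mu * (C - kap * r ^ 2)) (fun r => Z1 r + - 2 * mu * kap * r)
  (fun r => Z r - mu * (C - kap * r ^ 2)) (fun r => Z1 r - - 2 * mu * kap * r)
  rho sg (- Z1 rho / rho + G rho + - 2 * mu * kap)
  (- Z1 sg / sg + G sg - - 2 * mu * kap) d).
cut (- Z1 sg / sg + G sg - - 2 * mu * kap + (Z1 sg - - 2 * mu * kap * sg) / sg <=
  - Z1 rho / rho + G rho + - 2 * mu * kap + (Z1 rho + - 2 * mu * kap * rho) / rho).
{ replace (- Z1 sg / sg + G sg - - 2 * mu * kap + (Z1 sg - - 2 * mu * kap * sg) / sg)
    with (G sg + 4 * kap * mu) by (field; lra).
  replace (- Z1 rho / rho + G rho + - 2 * mu * kap + (Z1 rho + - 2 * mu * kap * rho) / rho)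
    with (G rho - 4 * kap * mu) by (field; lra).
  lra. }
apply H; [easy|lra|lra| | | | |easy|].
- intros t Ht. apply (is_derive_plus Z); [apply HZ, HD1; lra|apply Hp].
- apply (is_derive_plus Z1); [apply HZ1, Hr|apply Hp1].
- intros t Ht. apply (is_derive_minus Z); [apply HZ, HD2; lra|apply Hp].
- apply (is_derive_minus Z1); [apply HZ1, Hsd|apply Hp1].
- intros r t Hr' Ht' L. apply M; lra.
Qed.

Lemma f_decr x y1 y2 : 0 <= x -> y2 <= y1 -> ga * y1 <= be -> f x y1 <= f x y2.
Proof.
intros Hx Hy H. assert (Hga := ga_pos HP).
assert (0 <= x * ((y1 - y2) * (be / 3 - ga * (y1 + y2) / 6))).
{ apply Rmult_le_pos; [easy|]. apply Rmult_le_pos; [lra|].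
  assert (ga * y2 <= ga * y1) by (apply Rmult_le_compat_l; lra). lra. }
assert (E : f x y2 - f x y1 = x * ((y1 - y2) * (be / 3 - ga * (y1 + y2) / 6)))
  by (unfold f, f_rhs; field).
lra.
Qed.

Lemma g_decr x1 x2 y : 0 <= x2 -> x2 < x1 -> ga * y < be -> g x1 y < g x2 y.
Proof.
intros Hx H Hy.
assert (E : g x2 y - g x1 y = (be - ga * y) * ((x1 - x2) * (x1 + x2)) / 2)
  by (unfold g, g_rhs; field).
assert (0 < (be - ga * y) * ((x1 - x2) * (x1 + x2))); [|lra].
repeat apply Rmult_lt_0_compat; lra.
Qed.

Lemma ordered_near lam rho sg : ordered lam -> 0 < sg < rho -> 2 * lam <= rho + sg ->
  exists e, 0 < e /\ forall r t, rho - e < r < rho + e -> sg - e < t < sg + e ->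
    rho + sg <= r + t -> X t <= X r /\ Y t <= Y r.
Proof.
intros O H L. exists (Rmin sg ((rho - sg) / 2)).
assert (L1 := Rmin_l sg ((rho - sg) / 2)). assert (L2 := Rmin_r sg ((rho - sg) / 2)).
split; [apply Rmin_glb_lt; lra|]. intros r t Hr Ht Hrt. apply O; lra.
Qed.

(** At equal values of [X] the contact inequality would order the right-hand sides, but [K X / r^2]
    is strictly larger at the smaller radius and [f] does not increase with y. *)
Lemma X_strict lam sg rho : ordered lam -> 0 <= sg -> sg < rho -> 2 * lam <= rho + sg ->
  sg = 0 \/ D sg -> X sg < X rho.
Proof.
intros O H0 Hsr L HDs.
destruct (classic (D rho)) as [HD|HD].
2:{ rewrite (X_right HP rho) by (easy || lra).
    destruct HDs as [E|HDs]; [subst sg; rewrite X_0; apply (s_pos HP)|now apply X_lt_s]. }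
destruct HDs as [E|HDs]; [subst sg; rewrite X_0; apply (X_pos HP rho HD)|].
assert (Hs := D_pos sg HDs).
destruct (O sg rho H0 Hsr L) as [LX LY].
destruct (Rle_lt_or_eq_dec _ _ LX) as [|E]; [easy|exfalso].
destruct (ordered_near lam rho sg O (conj Hs Hsr) L) as [e [He M]].
assert (H := contact_quadratic X p (fun r => K * X r / r ^ 2 + f (X r) (Y r)) 0 0 0 rho sg e
  (X_der HP) p_der' HD (conj Hs Hsr) He).
cbv beta in H. rewrite E in H.
assert (H1 : f (X rho) (Y rho) <= f (X rho) (Y sg)).
{ apply f_decr; [apply Rlt_le, (X_pos HP rho HD)|easy|].
  apply Rlt_le, gaY_lt_be; lra. }
assert (H2 : K * X rho / rho ^ 2 < K * X rho / sg ^ 2).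
{ apply Rmult_lt_compat_l; [apply Rmult_lt_0_compat; [apply (K_pos HP)|apply (X_pos HP rho HD)]|].
  apply Rinv_lt_contravar; [apply Rmult_lt_0_compat; apply pow_lt; lra|].
  rewrite <- !Rsqr_pow2. apply Rsqr_incrst_1; lra. }
assert (H3 : K * X rho / sg ^ 2 + f (X rho) (Y sg) <=
  K * X rho / rho ^ 2 + f (X rho) (Y rho) - 8 * 0 * 0).
{ apply H; [lra|]. intros r t Hr Ht Hrt. destruct (M r t Hr Ht Hrt). lra. }
lra.
Qed.

Lemma Y_slope_0 e : 0 < e -> exists d, 0 < d /\ forall t, 0 < t < d -> y0 - e * t <= Y t.
Proof.
intros He. destruct (q_lim HP e He) as [d1 [Hd1 H1]].
destruct D_near_0 as [d2 [Hd2 H2]].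
assert (L1 := Rmin_l d1 d2). assert (L2 := Rmin_r d1 d2).
exists (Rmin d1 d2); split; [apply Rmin_glb_lt; lra|].
intros t Ht. apply Rnot_lt_le; intros N.
destruct (Y_near_0 (y0 - e * t - Y t)) as [d3 [Hd3 H3]]; [lra|].
set (t' := Rmin (t / 2) (d3 / 2)).
assert (L3 := Rmin_l (t / 2) (d3 / 2)). assert (L4 := Rmin_r (t / 2) (d3 / 2)).
fold t' in L3, L4. assert (0 < t') by (apply Rmin_glb_lt; lra).
assert (H4 := H3 t' ltac:(lra)). apply Rabs_def2 in H4.
destruct (is_derive_MVT Y q t' t) as [c [Hc E]]; [lra| |].
- intros r Hr. apply (Y_der HP), H2; lra.
- assert (H5 := H1 c ltac:(lra)). apply Rabs_def2 in H5.
  assert (- e * (t - t') <= q c * (t - t')) by (apply Rmult_le_compat_r; lra).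
  assert (0 < e * t') by (apply Rmult_lt_0_compat; lra). lra.
Qed.

(** A contact with sg = 0 has no room to the left, so the contact lemma does not apply. Equality
    would give g(0, y0) <= 0 and q(rho) = 0, hence g(X rho, y0) >= 0, contrary to the strict
    decrease of [g] in x. *)
Lemma Y_strict_0 lam rho : ordered lam -> 0 < rho -> 2 * lam <= rho -> D rho -> y0 < Y rho.
Proof.
intros O H0 L HD. rewrite <- Y_0.
destruct (O 0 rho (Rle_refl 0) H0 ltac:(lra)) as [_ LY].
destruct (Rle_lt_or_eq_dec _ _ LY) as [|E]; [easy|exfalso].
assert (G0 : g 0 y0 <= 0).
{ apply Rnot_lt_le; intros N.
  assert (N' : 0 < g (X 0) (Y 0)) by now rewrite X_0, Y_0.
  destruct (continuous_eps _ 0 _ (g_continuous 0) N') as [d [Hd H]].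
  destruct D_near_0 as [d' [Hd' HD']].
  set (d1 := Rmin rho (Rmin d d')).
  assert (L1 := Rmin_l rho (Rmin d d')). assert (L2 := Rmin_r rho (Rmin d d')). fold d1 in L1, L2.
  assert (L3 := Rmin_l d d'). assert (L4 := Rmin_r d d').
  assert (Hd1 : 0 < d1) by (repeat apply Rmin_glb_lt; lra).
  assert (y0 < Y (d1 / 2)).
  { apply (Y_increase_near_0 d1); [intros t Ht; apply HD'; lra| |lra].
    intros t Ht. assert (Ht' : Rabs (t - 0) < d) by (rewrite Rminus_0_r, Rabs_pos_eq; lra).
    specialize (H t Ht'). apply Rabs_def2 in H. lra. }
  destruct (O (d1 / 2) rho) as [_ H6]; try lra. rewrite Y_0 in E. lra. }
destruct (D_nbhd rho HD) as [e [He [Her HDe]]].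
assert (Q0 : 0 <= q rho).
{ apply (right_min_derive_ge0 Y rho _ e (Y_der HP rho HD) He).
  intros t Ht. rewrite <- E. apply O; lra. }
(* The pairs (t, rho - t) keep the sum rho. If q(rho) > 0, then Y(rho - t) < y0 - q(rho) t / 2 for
   small t, whereas Y(t) is at least that much because [q] tends to 0 at the origin. *)
assert (Q1 : q rho <= 0).
{ apply Rnot_lt_le; intros N.
  destruct (is_derive_pos_increase (fun r => Y r - q rho / 2 * r) rho (q rho - q rho / 2))
    as [e1 [He1 H1]]; [|lra|].
  - apply (is_derive_minus Y); [apply (Y_der HP rho HD)|].
    auto_derive; [easy|ring].
  - destruct (Y_slope_0 (q rho / 2) ltac:(lra)) as [e2 [He2 H2]].
    set (t := Rmin (rho / 4) (Rmin (e1 / 2) (e2 / 2))).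
    assert (0 < t) by (repeat apply Rmin_glb_lt; lra).
    assert (L1 := Rmin_l (rho / 4) (Rmin (e1 / 2) (e2 / 2))).
    assert (L2 := Rmin_r (rho / 4) (Rmin (e1 / 2) (e2 / 2))). fold t in L1, L2.
    assert (L3 := Rmin_l (e1 / 2) (e2 / 2)). assert (L4 := Rmin_r (e1 / 2) (e2 / 2)).
    destruct (H1 t ltac:(lra)) as [_ H3]. assert (H4 := H2 t ltac:(lra)).
    destruct (O t (rho - t)) as [_ H5]; try lra.
    rewrite Y_0 in E. lra. }
assert (Q : q rho = 0) by lra.
assert (H2 : 0 <= - q rho / rho + g (X rho) (Y rho)).
{ apply (second_derive_right_min Y q rho _ e He); [|easy|apply (q_der HP rho HD)|].
  - intros t Ht. apply (Y_der HP), HDe; lra.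
  - intros t Ht. rewrite <- E. apply O; lra. }
rewrite Q, <- E, Y_0 in H2.
assert (g (X rho) y0 < g 0 y0).
{ apply g_decr; [lra|apply (X_pos HP rho HD)|]. rewrite <- Y_0. apply gaY_lt_be; lra. }
unfold Rdiv in H2. lra.
Qed.

Lemma Y_strict lam sg rho : ordered lam -> 0 <= sg -> sg < rho -> 2 * lam <= rho + sg ->
  sg = 0 \/ D sg -> Y sg < Y rho.
Proof.
intros O H0 Hsr L HDs.
destruct (classic (D rho)) as [HD|HD].
2:{ rewrite (Y_right HP rho) by (easy || lra). now apply Y_lt_m. }
assert (LX := X_strict lam sg rho O H0 Hsr L HDs).
destruct HDs as [E|HDs].
{ subst sg; rewrite Y_0. apply (Y_strict_0 lam); try easy; lra. }
assert (Hs := D_pos sg HDs).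
destruct (O sg rho H0 Hsr L) as [_ LY].
destruct (Rle_lt_or_eq_dec _ _ LY) as [|E]; [easy|exfalso].
destruct (ordered_near lam rho sg O (conj Hs Hsr) L) as [e [He M]].
assert (H := contact_quadratic Y q (fun r => g (X r) (Y r)) 0 0 0 rho sg e
  (Y_der HP) (q_der HP) HD (conj Hs Hsr) He).
assert (H1 : g (X rho) (Y rho) < g (X sg) (Y rho)).
{ apply g_decr; [apply X_nonneg; lra|easy|apply gaY_lt_be; lra]. }
cbv beta in H. rewrite E in H.
assert (H3 : g (X sg) (Y rho) <= g (X rho) (Y rho) - 8 * 0 * 0).
{ apply H; [lra|]. intros r t Hr Ht Hrt. destruct (M r t Hr Ht Hrt). lra. }
lra.
Qed.

(** Pairs (t, t + h) give p, q >= 0; symmetric pairs around r give strictness through the third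
    derivative. For [X] the negative source is the K term, for [Y] it is [X p (ga Y - be)], so p > 0
    is needed first. *)
Lemma ordered_derive_pos lam r : ordered lam -> D r -> lam <= r -> 0 < p r /\ 0 < q r.
Proof.
intros O Hr L. assert (H0 := D_pos r Hr).
assert (N : forall t, D t -> lam <= t -> 0 <= p t /\ 0 <= q t).
{ intros t Ht Lt. assert (Ht0 := D_pos t Ht). split.
  - apply (right_min_derive_ge0 X t _ 1 (X_der HP t Ht)); [lra|].
    intros h Hh. apply O; lra.
  - apply (right_min_derive_ge0 Y t _ 1 (Y_der HP t Ht)); [lra|].
    intros h Hh. apply O; lra. }
destruct (D_nbhd r Hr) as [e [He [Her HD]]].
assert (Hp : 0 < p r).
{ apply (p_pos_of_symmetric r e Hr He).
  - intros t Ht. apply O; lra.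
  - intros t Ht. apply N; [apply HD|]; lra.
  - now apply N.
  - apply Rlt_le, gaY_lt_be; lra. }
split; [easy|].
assert (Q0 := proj2 (N r Hr L)).
destruct (Rle_lt_or_eq_dec _ _ Q0) as [|E]; [easy|exfalso].
assert (Z : q r = 0) by easy.
assert (H1 : 0 <= - q r / r + g (X r) (Y r)).
{ apply (right_min_derive_ge0 q r _ e); [apply (q_der HP r Hr)|easy|].
  intros t Ht. rewrite Z. apply N; [apply HD|]; lra. }
assert (S : forall t, 0 < t < e -> Y (r - t) <= Y (r + t)) by (intros t Ht; apply O; lra).
assert (H2 := symmetric_third_derive Y q _ r _ e He
  (fun t Ht => Y_der HP t (HD t ltac:(lra))) (fun t Ht => q_der HP t (HD t ltac:(lra)))
  (q_critical_derive r Hr Z) Z S).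
set (q' := - q r / r + g (X r) (Y r)) in *.
assert (0 <= q' / r) by (apply Rdiv_le_0_compat; lra).
assert (0 < X r * p r * (be - ga * Y r)).
{ assert (Hb := gaY_lt_be r ltac:(lra)). assert (HX := X_pos HP r Hr).
  apply Rmult_lt_0_compat; [apply Rmult_lt_0_compat|]; lra. }
unfold Rdiv in *. lra.
Qed.

(** * Lowering lambda to 0 *)

Lemma pos_derive_increase (Z z : R -> R) r : D r -> (forall t, D t -> is_derive Z t (z t)) ->
  continuous z r -> 0 < z r ->
  exists e, 0 < e /\ forall a b, r - e < a -> a < b -> b < r + e -> Z a < Z b.
Proof.
intros Hr HZ Cz Pz.
destruct (continuous_eps z r (z r) Cz Pz) as [e1 [He1 H1]].
destruct (D_nbhd r Hr) as [e2 [He2 [_ HD]]].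
assert (L1 := Rmin_l e1 e2). assert (L2 := Rmin_r e1 e2).
exists (Rmin e1 e2); split; [apply Rmin_glb_lt; lra|].
intros a b Ha Hab Hb.
destruct (is_derive_MVT Z z a b Hab) as [c [Hc E]]; [intros t Ht; apply HZ, HD; lra|].
assert (H2 : Rabs (z c - z r) < z r) by (apply H1, Rabs_def1; lra).
apply Rabs_def2 in H2. assert (0 < z c * (b - a)) by (apply Rmult_lt_0_compat; lra). lra.
Qed.

Lemma pos_gap_stable (Z : R -> R) a b : (forall r, continuous Z r) -> Z a < Z b ->
  exists e, 0 < e /\ forall x y, Rabs (x - a) < e -> Rabs (y - b) < e -> Z x <= Z y.
Proof.
intros C H. assert (Hh : 0 < (Z b - Z a) / 2) by lra.
destruct (continuous_eps Z a _ (C a) Hh) as [e1 [He1 H1]].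
destruct (continuous_eps Z b _ (C b) Hh) as [e2 [He2 H2]].
assert (L1 := Rmin_l e1 e2). assert (L2 := Rmin_r e1 e2).
exists (Rmin e1 e2); split; [apply Rmin_glb_lt; lra|].
intros x y Hx Hy. assert (Hx' := H1 x ltac:(lra)). assert (Hy' := H2 y ltac:(lra)).
apply Rabs_def2 in Hx'. apply Rabs_def2 in Hy'. lra.
Qed.

Lemma ordered_open lam : ordered lam -> D lam -> exists e, 0 < e /\ ordered (lam - e).
Proof.
intros O HD. assert (H0 := D_pos lam HD).
(* Only pairs with midpoint l in [lam - e, lam] are new; each is fixed by l and its smaller element.
   Smaller elements below lam have a strict gap, and near lam the positive derivatives take over. *)
destruct (local_to_uniform 0 lam (fun e sg => forall l, lam - e <= l <= lam -> sg < l ->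
  X sg <= X (2 * l - sg) /\ Y sg <= Y (2 * l - sg))) as [e [He H]].
- intros e e' x He H l Hl Hx. apply H; lra.
- intros u Hu. destruct (Rle_lt_or_eq_dec u lam (proj2 Hu)) as [L|E].
  + assert (HDu : u = 0 \/ D u).
    { destruct (Rle_lt_or_eq_dec 0 u (proj1 Hu)); [right|left; lra].
      apply (D_down lam); [easy|lra]. }
    destruct (pos_gap_stable X u (2 * lam - u) (X_cont HP)) as [e1 [He1 H1]];
      [apply (X_strict lam); try easy; lra|].
    destruct (pos_gap_stable Y u (2 * lam - u) (Y_cont HP)) as [e2 [He2 H2]];
      [apply (Y_strict lam); try easy; lra|].
    assert (L1 := Rmin_l e1 e2). assert (L2 := Rmin_r e1 e2).
    assert (0 < Rmin e1 e2) by (apply Rmin_glb_lt; lra).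
    (* The reflected point 2 l - x moves by less than three times the radius. *)
    exists (Rmin e1 e2 / 3); split; [lra|].
    intros x Hx l Hl _. apply Rabs_def2 in Hx.
    split; [apply H1|apply H2]; apply Rabs_def1; lra.
  + subst u. destruct (ordered_derive_pos lam lam O HD (Rle_refl lam)) as [Pp Pq].
    destruct (pos_derive_increase X p lam HD (X_der HP)) as [e1 [He1 H1]]; [|easy|].
    { apply (ex_derive_continuous (K := R_AbsRing) (V := R_NormedModule) p).
      eexists; apply (p_der HP lam HD). }
    destruct (pos_derive_increase Y q lam HD (Y_der HP)) as [e2 [He2 H2]]; [|easy|].
    { apply (ex_derive_continuous (K := R_AbsRing) (V := R_NormedModule) q).
      eexists; apply (q_der HP lam HD). }
    assert (L1 := Rmin_l e1 e2). assert (L2 := Rmin_r e1 e2).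
    assert (0 < Rmin e1 e2) by (apply Rmin_glb_lt; lra).
    exists (Rmin e1 e2 / 3); split; [lra|].
    intros x Hx l Hl Hxl. apply Rabs_def2 in Hx.
    split; apply Rlt_le; [apply H1|apply H2]; lra.
- exists e; split; [easy|]. intros sg rho Hs Hsr L.
  destruct (Rle_lt_dec (2 * lam) (rho + sg)) as [L1|L1]; [now apply O|].
  replace rho with (2 * ((rho + sg) / 2) - sg) by field.
  apply H; lra.
Qed.

Lemma continuous_right_le (Z : R -> R) a r : continuous Z r ->
  (forall h, 0 < h -> a <= Z (r + h)) -> a <= Z r.
Proof.
intros C H. apply Rnot_lt_le; intros N.
destruct (continuous_eps Z r (a - Z r) C ltac:(lra)) as [e [He H1]].
assert (H2 : Rabs (Z (r + e / 2) - Z r) < a - Z r) by (apply H1, Rabs_def1; lra).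
apply Rabs_def2 in H2. specialize (H (e / 2) ltac:(lra)). lra.
Qed.

Lemma ordered_all lam0 : D lam0 -> ordered lam0 -> forall l, 0 < l -> ordered l.
Proof.
intros HD0 O0 l1 Hl1. apply NNPP; intros N.
assert (B : forall l, ~ ordered l -> l < lam0).
{ intros l Hl. apply Rnot_le_lt; intros L. apply Hl. intros sg rho Hs Hsr H. apply O0; lra. }
destruct (completeness (fun l => ~ ordered l)) as [I [HI1 HI2]].
- exists lam0. intros l Hl. apply Rlt_le, B, Hl.
- now exists l1.
- assert (L1 : l1 <= I) by now apply HI1.
  assert (L2 : I <= lam0) by (apply HI2; intros l Hl; apply Rlt_le, B, Hl).
  assert (HDI : D I) by (apply (D_down lam0); [easy|lra]).
  (* The order passes to the supremum of the failing values: raising rho by h gives a pair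
     admissible for I + h / 2, where the order holds. *)
  assert (OI : ordered I).
  { intros sg rho Hs Hsr H.
    assert (Hh : forall h, 0 < h -> X sg <= X (rho + h) /\ Y sg <= Y (rho + h)).
    { intros h Hh. apply NNPP; intros N'.
      assert (~ ordered (I + h / 2)).
      { intros O'. apply N', O'; lra. }
      assert (I + h / 2 <= I) by now apply HI1. lra. }
    split; [apply (continuous_right_le X _ _ (X_cont HP rho))
           |apply (continuous_right_le Y _ _ (Y_cont HP rho))]; intros h H'; now apply Hh. }
  destruct (ordered_open I OI HDI) as [e [He Oe]].
  assert (I <= I - e); [|lra].
  apply HI2. intros l Hl. apply Rnot_lt_le; intros L. apply Hl.
  intros sg rho Hs Hsr H. apply Oe; lra.
Qed.

(** * Starting lambda near the end of the interval *)

Definition secant_fx (x1 y1 x2 y2 : R) : R :=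
  - al - be * y1 / 3 + ga * (x1 * x1 + x1 * x2 + x2 * x2) / 2 + ga * y1 * y1 / 6.
Definition secant_fy (x1 y1 x2 y2 : R) : R := x2 * (ga * (y1 + y2) / 6 - be / 3).
Definition secant_gx (x1 y1 x2 y2 : R) : R := (ga * y1 - be) * (x1 + x2) / 2.
Definition secant_gy (x1 y1 x2 y2 : R) : R :=
  - al + be * (y1 + y2) / 6 + ga * x2 * x2 / 2 + ga * (y1 * y1 + y1 * y2 + y2 * y2) / 6.

(** The increment is split at the intermediate point (x2, y1). In the cooperative range the
    off-diagonal secants then have a definite sign for arbitrary pairs, not only close ones. *)
Lemma secant_f x1 y1 x2 y2 : f x1 y1 - f x2 y2 =
  secant_fx x1 y1 x2 y2 * (x1 - x2) + secant_fy x1 y1 x2 y2 * (y1 - y2).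
Proof. unfold f, f_rhs, secant_fx, secant_fy. field. Qed.

Lemma secant_g x1 y1 x2 y2 : g x1 y1 - g x2 y2 =
  secant_gx x1 y1 x2 y2 * (x1 - x2) + secant_gy x1 y1 x2 y2 * (y1 - y2).
Proof. unfold g, g_rhs, secant_gx, secant_gy. field. Qed.

Section Start.
Variables (M0 w1 w2 C kap c0 : R).
Let psi (r : R) : R := C - kap * r ^ 2.
Hypothesis HM0 : D M0.
Hypothesis Hw1 : 0 < w1.
Hypothesis Hw2 : 0 < w2.
Hypothesis Hc0 : 0 < c0.
Hypothesis Hpsi : forall r, M0 <= r -> D r -> c0 <= psi r.
(** The vector (w1 psi, w2 psi), summed over both points, is a strict supersolution of the system
    linearized by secants: the left-hand sides are the sums of the radial Laplacians. *)
Hypothesis Hlin : forall r1 r2, M0 <= r1 -> M0 <= r2 -> D r1 -> D r2 ->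
  - 8 * kap * w1 < (psi r1 + psi r2) *
    (secant_fx (X r1) (Y r1) (X r2) (Y r2) * w1 + secant_fy (X r1) (Y r1) (X r2) (Y r2) * w2) /\
  - 8 * kap * w2 < (psi r1 + psi r2) *
    (secant_gx (X r1) (Y r1) (X r2) (Y r2) * w1 + secant_gy (X r1) (Y r1) (X r2) (Y r2) * w2).

Lemma bounded_before_end (Z : R -> R) l : (forall r, continuous Z r) ->
  (forall r, r = 0 \/ D r -> Z r < l) ->
  exists b, b < l /\ forall r, 0 <= r <= M0 -> Z r <= b.
Proof.
intros HC HZ. assert (H0 := D_pos M0 HM0).
destruct (continuity_ab_maj Z 0 M0) as [a [H1 Ha]]; [lra| |].
- intros r _. apply continuity_pt_filterlim, HC.
- exists (Z a); split; [|easy]. apply HZ.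
  destruct (Rle_lt_or_eq_dec 0 a (proj1 Ha)); [right|left; lra].
  apply (D_down M0); [easy|lra].
Qed.

Lemma quotient_continuous (Z : R -> R) w u v : (forall r, continuous Z r) -> 0 < w ->
  M0 <= u -> D u -> M0 <= v -> D v ->
  continuity_2d_pt (fun r t => (Z r - Z t) * / (w * (psi r + psi t))) u v.
Proof.
intros HC Hw Hu HDu Hv HDv.
assert (P1 := Hpsi u Hu HDu). assert (P2 := Hpsi v Hv HDv).
apply continuity_2d_pt_mult.
- apply continuity_2d_pt_minus.
  + apply (continuity_1d_2d_pt_comp Z (fun r _ => r)); [apply continuity_pt_filterlim, HC|].
    apply continuity_2d_pt_id1.
  + apply (continuity_1d_2d_pt_comp Z (fun _ t => t)); [apply continuity_pt_filterlim, HC|].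
    apply continuity_2d_pt_id2.
- assert (Cpsi : forall r, continuity_pt psi r).
  { intros r. apply continuity_pt_filterlim.
    apply (ex_derive_continuous (K := R_AbsRing) (V := R_NormedModule) psi).
    unfold psi. auto_derive. easy. }
  apply continuity_2d_pt_inv.
  + apply continuity_2d_pt_mult; [apply continuity_2d_pt_const|].
    apply continuity_2d_pt_plus.
    * apply (continuity_1d_2d_pt_comp psi (fun r _ => r)); [apply Cpsi|apply continuity_2d_pt_id1].
    * apply (continuity_1d_2d_pt_comp psi (fun _ t => t)); [apply Cpsi|apply continuity_2d_pt_id2].
  + apply Rgt_not_eq, Rmult_lt_0_compat; lra.
Qed.

Lemma quotient_min (Z : R -> R) w lam N : (forall r, continuous Z r) -> 0 < w ->
  M0 <= lam <= N -> D N ->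
  exists rho sg k, M0 <= sg /\ sg <= rho /\ rho <= N /\ 2 * lam <= rho + sg /\
    Z rho - Z sg = k * (w * (psi rho + psi sg)) /\
    forall r t, M0 <= t -> t <= r -> r <= N -> 2 * lam <= r + t ->
      k * (w * (psi r + psi t)) <= Z r - Z t.
Proof.
intros HC Hw HN HDN. assert (H0 := D_pos M0 HM0).
assert (HD : forall r, M0 <= r <= N -> D r) by (intros r Hr; apply (D_down N); [easy|lra]).
assert (Pp : forall r t, M0 <= r <= N -> M0 <= t <= N -> 0 < w * (psi r + psi t)).
{ intros r t Hr Ht. assert (P1 := Hpsi r (proj1 Hr) (HD r Hr)).
  assert (P2 := Hpsi t (proj1 Ht) (HD t Ht)). apply Rmult_lt_0_compat; lra. }
destruct (compact_min_2d M0 N M0 N (fun r t => t <= r /\ 2 * lam <= r + t)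
  (fun r t => (Z r - Z t) * / (w * (psi r + psi t)))) as [rho [sg [[Hr [Hs [L1 L2]]] M]]].
- intros u v Hu Hv. apply quotient_continuous; try easy; now apply HD.
- intros u v N'.
  assert (N'' : u < v \/ u + v < 2 * lam).
  { destruct (Rlt_le_dec u v); [now left|right]. apply Rnot_le_lt. tauto. }
  destruct N'' as [L|L].
  + assert (He : 0 < (v - u) / 2) by lra. exists (mkposreal _ He); simpl.
    intros x y Hx Hy [H1 _]. apply Rabs_def2 in Hx. apply Rabs_def2 in Hy. lra.
  + assert (He : 0 < (2 * lam - (u + v)) / 2) by lra. exists (mkposreal _ He); simpl.
    intros x y Hx Hy [_ H1]. apply Rabs_def2 in Hx. apply Rabs_def2 in Hy. lra.
- exists lam, lam. lra.
- set (k := (Z rho - Z sg) * / (w * (psi rho + psi sg))) in M.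
  exists rho, sg, k. repeat split; try lra.
  + unfold k. rewrite Rmult_assoc, Rinv_l, Rmult_1_r; [easy|].
    apply Rgt_not_eq, Pp; easy.
  + intros r t H1 H2 H3 H4.
    assert (P := Pp r t ltac:(lra) ltac:(lra)).
    assert (H5 := M r t ltac:(lra) ltac:(lra) (conj H2 H4)).
    apply (Rmult_le_compat_r (w * (psi r + psi t))) in H5; [|lra].
    rewrite Rmult_assoc, Rinv_l, Rmult_1_r in H5; lra.
Qed.

(** Off the sides sg = M0, sg = rho and rho = N of the domain, a minimal quotient k is a contact
    with multiplier [- (k * w)]; the side rho + sg = 2 lam is allowed. *)
Lemma contact_in_triangle (Z Z1 G : R -> R) w k lam N rho sg :
  (forall r, D r -> is_derive Z r (Z1 r)) ->
  (forall r, D r -> is_derive Z1 r (- Z1 r / r + G r)) ->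
  D N -> M0 < sg -> sg < rho -> rho < N -> 2 * lam <= rho + sg ->
  Z rho - Z sg = k * (w * (psi rho + psi sg)) ->
  (forall r t, M0 <= t -> t <= r -> r <= N -> 2 * lam <= r + t ->
      k * (w * (psi r + psi t)) <= Z r - Z t) ->
  G sg <= G rho + 8 * kap * (k * w).
Proof.
intros HZ HZ1 HDN H1 H2 H3 H4 E M. assert (H0 := D_pos M0 HM0).
replace (8 * kap * (k * w)) with (- (8 * kap * - (k * w))) by ring.
set (e := Rmin (sg - M0) (Rmin (N - rho) ((rho - sg) / 2))).
assert (L1 := Rmin_l (sg - M0) (Rmin (N - rho) ((rho - sg) / 2))).
assert (L2 := Rmin_r (sg - M0) (Rmin (N - rho) ((rho - sg) / 2))). fold e in L1, L2.
assert (L3 := Rmin_l (N - rho) ((rho - sg) / 2)). assert (L4 := Rmin_r (N - rho) ((rho - sg) / 2)).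
apply (contact_quadratic Z Z1 G (- (k * w)) C kap rho sg e HZ HZ1).
- apply (D_down N); [easy|lra].
- lra.
- repeat apply Rmin_glb_lt; lra.
- unfold psi in E. lra.
- intros r t Hr Ht Hrt. assert (H5 := M r t ltac:(lra) ltac:(lra) ltac:(lra) ltac:(lra)).
  unfold psi in H5. lra.
Qed.

(** A pair out of order makes one minimal quotient negative. The component with the smaller quotient
    is examined at its minimizer: the other difference is then bounded below by the same multiple of
    its own weight, which is what the off-diagonal sign can use. *)
Lemma ordered_start : exists lam, D lam /\ ordered lam.
Proof.
destruct (bounded_before_end X s (X_cont HP)) as [bX [HbX BX]].
{ intros r [E|Hr]; [subst r; rewrite X_0; apply (s_pos HP)|now apply X_lt_s]. }
destruct (bounded_before_end Y m (Y_cont HP)) as [bY [HbY BY]]; [exact Y_lt_m|].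
(* From [lam] on, both components exceed their maxima on [0, M0], so a pair out of order must have
   sg > M0. *)
destruct (near_end M0 (Rmin (s - bX) (m - bY)) HM0) as [lam [HlM [HDl Hl]]];
  [apply Rmin_glb_lt; lra|].
assert (H0 := D_pos M0 HM0).
exists lam; split; [easy|]. apply NNPP; intros NO.
assert (Late : forall rho sg, 0 <= sg -> sg < rho -> 2 * lam <= rho + sg ->
  X rho < X sg \/ Y rho < Y sg -> M0 < sg).
{ intros rho sg Hs Hsr L H. apply Rnot_le_lt; intros N.
  destruct (Hl rho ltac:(lra)) as [H1 H2].
  assert (L1 := Rmin_l (s - bX) (m - bY)). assert (L2 := Rmin_r (s - bX) (m - bY)).
  apply Rabs_def2 in H1. apply Rabs_def2 in H2.
  assert (X sg <= bX) by (apply BX; lra). assert (Y sg <= bY) by (apply BY; lra). lra. }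
assert (Bad : exists sg rho, 0 <= sg /\ sg < rho /\ 2 * lam <= rho + sg /\
  (X rho < X sg \/ Y rho < Y sg)).
{ apply NNPP; intros N. apply NO. intros sg rho Hs Hsr L.
  split; apply Rnot_lt_le; intros H; apply N; exists sg, rho; tauto. }
destruct Bad as [sg0 [rho0 [Hs0 [Hsr0 [L0 H]]]]].
assert (HMs := Late rho0 sg0 Hs0 Hsr0 L0 H).
assert (HDr0 : D rho0).
{ apply NNPP; intros N.
  rewrite (X_right HP rho0), (Y_right HP rho0) in H by (easy || lra).
  assert (HX := X_le_s sg0 Hs0). assert (HY := Y_le_m sg0 Hs0). lra. }
assert (HDs0 : D sg0) by (apply (D_down rho0); [easy|lra]).
assert (P0 := Hpsi rho0 ltac:(lra) HDr0). assert (P0' := Hpsi sg0 ltac:(lra) HDs0).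
set (wm := Rmin w1 w2).
assert (W1 := Rmin_l w1 w2). assert (W2 := Rmin_r w1 w2). fold wm in W1, W2.
assert (Hwm : 0 < wm) by (apply Rmin_glb_lt; lra).
assert (Defect : exists k0, 0 < k0 /\ (X rho0 - X sg0 <= - k0 * (w1 * (psi rho0 + psi sg0)) \/
  Y rho0 - Y sg0 <= - k0 * (w2 * (psi rho0 + psi sg0)))).
{ destruct H as [H|H].
  - exists ((X sg0 - X rho0) / (w1 * (psi rho0 + psi sg0))).
    assert (0 < w1 * (psi rho0 + psi sg0)) by (apply Rmult_lt_0_compat; lra).
    split; [apply Rdiv_lt_0_compat; lra|left]. right. field. lra.
  - exists ((Y sg0 - Y rho0) / (w2 * (psi rho0 + psi sg0))).
    assert (0 < w2 * (psi rho0 + psi sg0)) by (apply Rmult_lt_0_compat; lra).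
    split; [apply Rdiv_lt_0_compat; lra|right]. right. field. lra. }
destruct Defect as [k0 [Hk0 Def]].
(* The least defect of a pair whose quotient is at most [- k0]. Past N the profiles are within [e]
   of their upper bounds, so no such defect occurs with rho >= N. *)
set (e := k0 * (wm * (2 * c0))).
assert (Hbig : forall w k r t, wm <= w -> k <= - k0 -> M0 <= r -> M0 <= t -> D r -> D t ->
  k * (w * (psi r + psi t)) <= - e).
{ intros w k r t Hw Hk Hr Ht HDr HDt. assert (P := Hpsi r Hr HDr). assert (P' := Hpsi t Ht HDt).
  assert (wm * (2 * c0) <= w * (psi r + psi t)) by (apply Rmult_le_compat; lra).
  assert (0 < wm * (2 * c0)) by (apply Rmult_lt_0_compat; lra).
  assert (k0 * (wm * (2 * c0)) <= - k * (w * (psi r + psi t))) by (apply Rmult_le_compat; lra).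
  unfold e; lra. }
assert (He : 0 < e) by (repeat apply Rmult_lt_0_compat; lra).
destruct (near_end lam e HDl He) as [N [HlN [HDN HN]]].
assert (Early : forall r t, 0 <= t -> X r - X t <= - e \/ Y r - Y t <= - e -> r < N).
{ intros r t Ht H1. apply Rnot_le_lt; intros L. destruct (HN r L) as [H2 H3].
  apply Rabs_def2 in H2. apply Rabs_def2 in H3.
  assert (HX := X_le_s t Ht). assert (HY := Y_le_m t Ht). lra. }
assert (HrN : rho0 < N).
{ apply (Early rho0 sg0 Hs0).
  destruct Def as [Def|Def]; [left|right]; apply Rle_trans with (1 := Def); apply Hbig; (lra || easy). }
destruct (quotient_min X w1 lam N (X_cont HP) Hw1 (conj HlM HlN) HDN)
  as [r1 [t1 [k1 [A1 [A2 [A3 [A4 [A5 A6]]]]]]]].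
destruct (quotient_min Y w2 lam N (Y_cont HP) Hw2 (conj HlM HlN) HDN)
  as [r2 [t2 [k2 [B1 [B2 [B3 [B4 [B5 B6]]]]]]]].
assert (Hk : k1 <= - k0 \/ k2 <= - k0).
{ destruct Def as [Def|Def]; [left|right].
  - assert (H1 := A6 rho0 sg0 ltac:(lra) ltac:(lra) ltac:(lra) L0).
    apply (Rmult_le_reg_r (w1 * (psi rho0 + psi sg0))); [apply Rmult_lt_0_compat|]; lra.
  - assert (H1 := B6 rho0 sg0 ltac:(lra) ltac:(lra) ltac:(lra) L0).
    apply (Rmult_le_reg_r (w2 * (psi rho0 + psi sg0))); [apply Rmult_lt_0_compat|]; lra. }
assert (HD : forall r, M0 <= r <= N -> D r) by (intros r Hr; apply (D_down N); [easy|lra]).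
destruct (Rle_lt_dec k1 k2) as [Lk|Lk].
- assert (Dr : D r1) by (apply HD; lra). assert (Dt : D t1) by (apply HD; lra).
  assert (Hk1 : k1 <= - k0) by lra.
  assert (HX : X r1 - X t1 <= - e) by (rewrite A5; apply Hbig; (lra || easy)).
  assert (Htr : t1 < r1).
  { destruct (Rle_lt_or_eq_dec t1 r1 A2) as [|E]; [easy|]. subst t1. lra. }
  assert (HMt : M0 < t1) by (apply (Late r1 t1); lra).
  assert (HrN1 : r1 < N) by (apply (Early r1 t1); lra).
  assert (Con := contact_in_triangle X p (fun r => K * X r / r ^ 2 + f (X r) (Y r)) w1 k1 lam N r1 t1
    (X_der HP) p_der' HDN HMt Htr HrN1 A4 A5 A6). cbv beta in Con.
  assert (HK : K * X r1 / r1 ^ 2 < K * X t1 / t1 ^ 2).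
  { assert (HKp := K_pos HP). assert (Xp := X_pos HP r1 Dr).
    apply Rlt_trans with (K * X t1 / r1 ^ 2).
    - apply Rmult_lt_compat_r; [apply Rinv_0_lt_compat, pow_lt; lra|].
      apply Rmult_lt_compat_l; lra.
    - apply Rmult_lt_compat_l; [apply Rmult_lt_0_compat; lra|].
      apply Rinv_lt_contravar; [apply Rmult_lt_0_compat; apply pow_lt; lra|].
      rewrite <- !Rsqr_pow2. apply Rsqr_incrst_1; lra. }
  assert (S := secant_f (X r1) (Y r1) (X t1) (Y t1)).
  destruct (Hlin r1 t1 ltac:(lra) ltac:(lra) Dr Dt) as [Hl1 _].
  assert (HB : secant_fy (X r1) (Y r1) (X t1) (Y t1) <= 0).
  { unfold secant_fy. assert (Xp := X_pos HP t1 Dt).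
    assert (Y1 := gaY_lt_be r1 ltac:(lra)). assert (Y2 := gaY_lt_be t1 ltac:(lra)).
    assert (0 <= X t1 * (be / 3 - ga * (Y r1 + Y t1) / 6)) by (apply Rmult_le_pos; lra). lra. }
  set (Aa := secant_fx (X r1) (Y r1) (X t1) (Y t1)) in *.
  set (Bb := secant_fy (X r1) (Y r1) (X t1) (Y t1)) in *.
  set (ph := psi r1 + psi t1) in *.
  assert (P : c0 <= psi r1) by (apply Hpsi; [lra|easy]). assert (P' : c0 <= psi t1) by (apply Hpsi; [lra|easy]).
  assert (Hph : 0 < ph) by (unfold ph; lra).
  (* Multiplied by [Bb <= 0] this bounds the coupling from above; [Hlin] times k1 < 0 then
     contradicts the contact inequality. *)
  assert (HY : k1 * (w2 * ph) <= Y r1 - Y t1).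
  { apply Rle_trans with (k2 * (w2 * ph)); [|apply B6; lra].
    apply Rmult_le_compat_r; [apply Rmult_le_pos; lra|lra]. }
  assert (S1 : Bb * (Y r1 - Y t1) <= Bb * (k1 * (w2 * ph))).
  { now apply Rmult_le_compat_neg_l. }
  rewrite A5 in S.
  assert (S2 : 0 < - k1 * (8 * kap * w1 + ph * (Aa * w1 + Bb * w2)))
    by (apply Rmult_lt_0_compat; lra).
  lra.
- assert (Dr : D r2) by (apply HD; lra). assert (Dt : D t2) by (apply HD; lra).
  assert (Hk2 : k2 <= - k0) by lra.
  assert (HY : Y r2 - Y t2 <= - e) by (rewrite B5; apply Hbig; (lra || easy)).
  assert (Htr : t2 < r2).
  { destruct (Rle_lt_or_eq_dec t2 r2 B2) as [|E]; [easy|]. subst t2. lra. }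
  assert (HMt : M0 < t2) by (apply (Late r2 t2); lra).
  assert (HrN2 : r2 < N) by (apply (Early r2 t2); lra).
  assert (Con := contact_in_triangle Y q (fun r => g (X r) (Y r)) w2 k2 lam N r2 t2
    (Y_der HP) (q_der HP) HDN HMt Htr HrN2 B4 B5 B6). cbv beta in Con.
  assert (S := secant_g (X r2) (Y r2) (X t2) (Y t2)).
  destruct (Hlin r2 t2 ltac:(lra) ltac:(lra) Dr Dt) as [_ Hl2].
  assert (HB : secant_gx (X r2) (Y r2) (X t2) (Y t2) <= 0).
  { unfold secant_gx. assert (Xp := X_pos HP t2 Dt). assert (Xp' := X_pos HP r2 Dr).
    assert (Y1 := gaY_lt_be r2 ltac:(lra)).
    assert (0 <= (be - ga * Y r2) * (X r2 + X t2)) by (apply Rmult_le_pos; lra). lra. }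
  set (Aa := secant_gx (X r2) (Y r2) (X t2) (Y t2)) in *.
  set (Bb := secant_gy (X r2) (Y r2) (X t2) (Y t2)) in *.
  set (ph := psi r2 + psi t2) in *.
  assert (P : c0 <= psi r2) by (apply Hpsi; [lra|easy]). assert (P' : c0 <= psi t2) by (apply Hpsi; [lra|easy]).
  assert (Hph : 0 < ph) by (unfold ph; lra).
  assert (HX : k2 * (w1 * ph) <= X r2 - X t2).
  { apply Rle_trans with (k1 * (w1 * ph)); [|apply A6; lra].
    apply Rmult_le_compat_r; [apply Rmult_le_pos; lra|lra]. }
  assert (S1 : Aa * (X r2 - X t2) <= Aa * (k2 * (w1 * ph))).
  { now apply Rmult_le_compat_neg_l. }
  rewrite B5 in S.
  assert (S2 : 0 < - k2 * (8 * kap * w2 + ph * (Aa * w1 + Bb * w2)))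
    by (apply Rmult_lt_0_compat; lra).
  lra.
Qed.
End Start.

(** * Choice of psi and of the weights *)

Lemma continuous_4_lt (F : R * R * (R * R) -> R) x1 y1 x2 y2 c :
  continuous F ((x1, y1), (x2, y2)) -> c < F ((x1, y1), (x2, y2)) ->
  exists e, 0 < e /\ forall x1' y1' x2' y2', Rabs (x1' - x1) < e -> Rabs (y1' - y1) < e ->
    Rabs (x2' - x2) < e -> Rabs (y2' - y2) < e -> c < F ((x1', y1'), (x2', y2')).
Proof.
intros HC Hc. assert (Hd : 0 < F (x1, y1, (x2, y2)) - c) by lra.
apply (proj1 (filterlim_locally F _)) with (eps := mkposreal _ Hd) in HC.
destruct HC as [e He]. exists e; split; [apply cond_pos|].
intros x1' y1' x2' y2' H1 H2 H3 H4.
assert (H : Rabs (F (x1', y1', (x2', y2')) - F (x1, y1, (x2, y2))) < F (x1, y1, (x2, y2)) - c)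
  by (apply He; repeat split; assumption).
apply Rabs_def2 in H. lra.
Qed.

(** The secants tend to the Jacobian at (s, m), whose entries take the stated form after elimination
    of al by [al_eq] and [m ^ 2 = s ^ 2]. *)
Lemma secants_near_limit M c1 c2 w1 w2 : D M ->
  c1 < ga * s ^ 2 * w1 + s * (ga * m - be) / 3 * w2 ->
  c2 < s * (ga * m - be) * w1 + (ga * m ^ 2 / 3 + 2 * be * m / 3) * w2 ->
  exists M0, M <= M0 /\ D M0 /\ forall r1 r2, M0 <= r1 -> M0 <= r2 ->
    c1 < secant_fx (X r1) (Y r1) (X r2) (Y r2) * w1 + secant_fy (X r1) (Y r1) (X r2) (Y r2) * w2 /\
    c2 < secant_gx (X r1) (Y r1) (X r2) (Y r2) * w1 + secant_gy (X r1) (Y r1) (X r2) (Y r2) * w2.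
Proof.
intros HM H1 H2. assert (Hal := al_eq HP). assert (Hms := m_sqr HP).
pose (F1 := fun z : R * R * (R * R) =>
  secant_fx (fst (fst z)) (snd (fst z)) (fst (snd z)) (snd (snd z)) * w1 +
  secant_fy (fst (fst z)) (snd (fst z)) (fst (snd z)) (snd (snd z)) * w2).
pose (F2 := fun z : R * R * (R * R) =>
  secant_gx (fst (fst z)) (snd (fst z)) (fst (snd z)) (snd (snd z)) * w1 +
  secant_gy (fst (fst z)) (snd (fst z)) (fst (snd z)) (snd (snd z)) * w2).
assert (C1 : forall z : R * R * (R * R), continuous (fun z : R * R * (R * R) => fst (fst z)) z).
{ intros z. apply (continuous_comp fst fst); apply continuous_fst. }
assert (C2 : forall z : R * R * (R * R), continuous (fun z : R * R * (R * R) => snd (fst z)) z).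
{ intros z. apply (continuous_comp fst snd); [apply continuous_fst|apply continuous_snd]. }
assert (C3 : forall z : R * R * (R * R), continuous (fun z : R * R * (R * R) => fst (snd z)) z).
{ intros z. apply (continuous_comp snd fst); [apply continuous_snd|apply continuous_fst]. }
assert (C4 : forall z : R * R * (R * R), continuous (fun z : R * R * (R * R) => snd (snd z)) z).
{ intros z. apply (continuous_comp snd snd); apply continuous_snd. }
destruct (continuous_4_lt F1 s m s m c1) as [e1 [He1 L1]].
{ specialize (C1 (s, m, (s, m))). specialize (C2 (s, m, (s, m))).
  specialize (C3 (s, m, (s, m))). specialize (C4 (s, m, (s, m))).
  unfold F1, secant_fx, secant_fy. continuous_poly. }
{ apply Rlt_le_trans with (1 := H1). right.
  unfold F1, secant_fx, secant_fy; simpl. rewrite Hal. replace (m * (m * 1)) with (s * s) by nra.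
  replace (ga * m * m / 6) with (ga * (s * s) / 6) by (replace (s * s) with (m * m) by nra; field).
  field. }
destruct (continuous_4_lt F2 s m s m c2) as [e2 [He2 L2]].
{ specialize (C1 (s, m, (s, m))). specialize (C2 (s, m, (s, m))).
  specialize (C3 (s, m, (s, m))). specialize (C4 (s, m, (s, m))).
  unfold F2, secant_gx, secant_gy. continuous_poly. }
{ apply Rlt_le_trans with (1 := H2). right.
  unfold F2, secant_gx, secant_gy; simpl. rewrite Hal.
  replace (ga * s * s) with (ga * (m * m)) by (replace (m * m) with (s * s) by nra; ring).
  replace (s ^ 2) with (m * m) by nra. field. }
destruct (near_end M (Rmin e1 e2) HM) as [M0 [HM0 [HD H]]]; [apply Rmin_glb_lt; lra|].
assert (R1 := Rmin_l e1 e2). assert (R2 := Rmin_r e1 e2).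
exists M0. split; [easy|]. split; [easy|]. intros r1 r2 Hr1 Hr2.
destruct (H r1 Hr1). destruct (H r2 Hr2).
split; [apply (L1 (X r1) (Y r1) (X r2) (Y r2))|apply (L2 (X r1) (Y r1) (X r2) (Y r2))]; lra.
Qed.

Lemma exists_ordered : exists lam, D lam /\ ordered lam.
Proof.
assert (Hga := ga_pos HP). assert (Hs := s_pos HP). assert (Hms := m_sqr HP).
set (A := ga * s ^ 2). set (B := s * (ga * m - be) / 3).
set (C := s * (ga * m - be)). set (E := ga * m ^ 2 / 3 + 2 * be * m / 3).
destruct (D_interval HP) as [[Re [HR HD]]|HD].
(* With weights 1, - L is below both row sums. Since (Re - r)(Re + r) <= 1/L for r in [M, Re), psi =
   Re^2 + 1/L - r^2 lies between 1/L and 2/L there, so the linear part stays above -4 and the bound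
   - 8 kap with kap = 1 is met. *)
- set (L := Rabs (A + B) + Rabs (C + E) + 1).
  assert (HA := Rle_abs (- (A + B))). assert (HC := Rle_abs (- (C + E))).
  rewrite Rabs_Ropp in HA, HC.
  assert (PA := Rabs_pos (A + B)). assert (PC := Rabs_pos (C + E)).
  assert (HL : 0 < L) by (unfold L; lra).
  set (M := Rmax (Re / 2) (Re - / (2 * Re * L))).
  assert (HI : 0 < / (2 * Re * L)) by (apply Rinv_0_lt_compat; repeat apply Rmult_lt_0_compat; lra).
  assert (HM : Re / 2 <= M < Re).
  { split; [apply Rmax_l|]. apply Rmax_lub_lt; lra. }
  assert (HM' := Rmax_r (Re / 2) (Re - / (2 * Re * L))). fold M in HM'.
  destruct (secants_near_limit M (- L) (- L) 1 1) as [M0 [HM0 [HDM0 H]]].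
  + apply HD; lra.
  + fold A B. unfold L; lra.
  + fold C E. unfold L; lra.
  + apply (ordered_start M0 1 1 (Re ^ 2 + / L) 1 (/ L)); try lra; try easy.
    * now apply Rinv_0_lt_compat.
    * intros r _ Hr. apply HD in Hr. assert (r ^ 2 <= Re ^ 2) by (apply pow_incr; lra). lra.
    * intros r1 r2 H1 H2 HD1 HD2. apply HD in HD1. apply HD in HD2.
      destruct (H r1 r2 H1 H2) as [S1 S2].
      assert (Hr : forall r, M0 <= r -> r < Re -> 0 < Re ^ 2 + / L - 1 * r ^ 2 <= 2 * / L).
      { intros r L1 L2. assert (0 < / L) by now apply Rinv_0_lt_compat.
        assert (E1 : Re ^ 2 - r ^ 2 = (Re - r) * (Re + r)) by ring.
        assert (0 <= (Re - r) * (Re + r)) by (apply Rmult_le_pos; lra).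
        assert (H7 : (Re - r) * (Re + r) <= / (2 * Re * L) * (2 * Re))
          by (apply Rmult_le_compat; lra).
        replace (/ (2 * Re * L) * (2 * Re)) with (/ L) in H7 by (field; lra). lra. }
      assert (P1 := Hr r1 H1 ltac:(lra)). assert (P2 := Hr r2 H2 ltac:(lra)).
      set (ph := Re ^ 2 + / L - 1 * r1 ^ 2 + (Re ^ 2 + / L - 1 * r2 ^ 2)) in *.
      assert (Hph : 0 < ph <= 4 * / L) by (unfold ph; lra).
      assert (G : forall z, - L < z -> - 8 < ph * z).
      { intros z Hz. assert (ph * - L < ph * z) by (apply Rmult_lt_compat_l; lra).
        assert (H7 : ph * L <= 4 * / L * L) by (apply Rmult_le_compat_r; lra).
        rewrite Rmult_assoc, Rinv_l in H7 by lra. lra. }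
      split; rewrite !Rmult_1_r in *; apply G; lra.
- (* Weights solving (A B; C E) w = det (1, 1). *)
  assert (Hdet : 0 < A * E - B * C).
  { assert (H := stab m (Rle_refl m) be_gt).
    replace (A * E - B * C) with (s ^ 2 * (be * (2 * ga * (m + m) - be)) / 3).
    - assert (0 < s ^ 2 * (be * (2 * ga * (m + m) - be))); [|lra].
      apply Rmult_lt_0_compat; [now apply pow_lt|easy].
    - unfold A, B, C, E. rewrite Hms. replace (s * (ga * m - be) / 3 * (s * (ga * m - be)))
        with (s ^ 2 * (ga ^ 2 * m ^ 2 - 2 * ga * be * m + be ^ 2) / 3) by field.
      rewrite Hms. field. }
  assert (HA : 0 < A) by (apply Rmult_lt_0_compat; [easy|now apply pow_lt]).
  assert (HC : 0 < - C).
  { replace (- C) with (s * (be - ga * m)) by (unfold C; ring). apply Rmult_lt_0_compat; lra. }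
  assert (HB : B = C / 3) by (unfold B, C; field).
  assert (HE : 0 < E).
  (* The positive determinant gives A E > B C = C^2 / 3 >= 0. *)
  { apply (Rmult_lt_reg_l A); [easy|]. rewrite HB in Hdet. nra. }
  destruct (D_near_0) as [d [Hd HDd]].
  destruct (secants_near_limit (d / 2) 0 0 (E - B) (A - C)) as [M0 [HM0 [HDM0 H]]].
  + apply HDd; lra.
  + fold A B. lra.
  + fold C E. lra.
  + apply (ordered_start M0 (E - B) (A - C) 1 0 1); try lra; try easy.
    * intros r _ _. lra.
    * intros r1 r2 H1 H2 _ _. destruct (H r1 r2 H1 H2).
      rewrite !Rmult_0_l, !Rminus_0_r, !Rmult_0_r, !Rmult_0_l.
      split; apply Rmult_lt_0_compat; lra.
Qed.

Lemma profile_increasing r : D r -> 0 < p r /\ 0 < q r.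
Proof.
intros Hr. destruct exists_ordered as [lam [HD O]].
apply (ordered_derive_pos r); [|easy|lra].
apply (ordered_all lam HD O), D_pos, Hr.
Qed.
End Cooperative.

(** * The case b^4 = 3 a^2 c^2 *)

Section Degenerate.

Hypothesis be_eq : be = ga * s.
Hypothesis m_eq : m = s.
Hypothesis Y_pos : forall r, D r -> 0 < Y r.

Lemma g_factor x y : g x y = ga * (y - s) * (x ^ 2 / 2 + y * (y + 2 * s) / 6).
Proof. unfold g, g_rhs. rewrite (al_eq HP), m_eq, be_eq. field. Qed.

(** For y > 0 the sign of [g] is that of y - s, so [Y] has neither a maximum above s nor a minimum
    below s. *)
Lemma Y_constant r : D r -> Y r = s.
Proof.
intros Hr. assert (H0 := D_pos r Hr). assert (Hs := s_pos HP). assert (Hga := ga_pos HP).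
assert (Pos : forall x y, 0 < y -> 0 < x ^ 2 / 2 + y * (y + 2 * s) / 6).
{ intros x y Hy. assert (0 <= x ^ 2) by apply pow2_ge_0.
  assert (0 < y * (y + 2 * s)) by (apply Rmult_lt_0_compat; lra). lra. }
apply Rle_antisym; apply Rnot_lt_le; intros N.
- destruct (max_of_limit_le Y m r (Y_cont HP) (Y_lim HP)) as [r1 [Hr1 [_ [L M]]]]; [lra|lra|].
  assert (Hg := g_at_max r1 (D_below_limit r1 Hr1 ltac:(lra)) M). rewrite g_factor in Hg.
  assert (0 < ga * (Y r1 - s) * (X r1 ^ 2 / 2 + Y r1 * (Y r1 + 2 * s) / 6)); [|lra].
  apply Rmult_lt_0_compat; [apply Rmult_lt_0_compat; lra|apply Pos; lra].
- destruct (max_of_limit_le (fun t => - Y t) (- m) r) as [r1 [Hr1 [_ [L M]]]]; [| |lra|lra|].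
  { intros t. apply continuous_neg, (Y_cont HP). }
  { intros e He. destruct (Y_lim HP e He) as [n Hn]. exists n. intros t Ht.
    replace (- Y t - - m) with (- (Y t - m)) by ring. rewrite Rabs_Ropp. now apply Hn. }
  assert (Neg : forall x y, 0 < y -> y < s -> g x y < 0).
  { intros x y Hy Hys. rewrite g_factor.
    assert (0 < ga * (s - y) * (x ^ 2 / 2 + y * (y + 2 * s) / 6)); [|lra].
    apply Rmult_lt_0_compat; [apply Rmult_lt_0_compat; lra|now apply Pos]. }
  destruct (D_below_limit r1 Hr1 ltac:(lra)) as [E|HD1].
  (* The value y0 may be 0, where g(0, y0) vanishes. The sign of [g] is therefore taken at nearby
     radii, where 0 < Y < s. *)
  + subst r1. rewrite Y_0 in *.
    destruct (Y_near_0 (s - y0)) as [d [Hd H]]; [lra|].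
    destruct D_near_0 as [d' [Hd' HD]].
    assert (L1 := Rmin_l d d'). assert (L2 := Rmin_r d d').
    assert (L0 : 0 < Rmin d d') by (apply Rmin_glb_lt; lra).
    assert (H1 : Y (Rmin d d' / 2) < y0); [|specialize (M (Rmin d d' / 2) ltac:(lra)); lra].
    apply (Y_decrease_near_0 (Rmin d d')); [intros t Ht; apply HD; lra| |lra].
    intros t Ht. assert (H1 := H t ltac:(lra)). apply Rabs_def2 in H1.
    apply Neg; [apply Y_pos, HD; lra|lra].
  + assert (H1 := D_pos r1 HD1).
    assert (Hg : 0 <= g (X r1) (Y r1)).
    { apply (radial_local_min Y q (fun t => g (X t) (Y t)) r1 r1 (Y_der HP) (q_der HP) HD1 H1).
      intros t Ht. specialize (M t ltac:(lra)). lra. }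
    assert (g (X r1) (Y r1) < 0); [|lra]. apply Neg; [now apply Y_pos|lra].
Qed.

Lemma scalar_X_lt_s r : D r -> X r < s.
Proof.
intros Hr. apply Rnot_le_lt; intros N. assert (H0 := D_pos r Hr). assert (Hs := s_pos HP).
destruct (max_of_limit_le X s r (X_cont HP) (X_lim HP)) as [r1 [Hr1 [E [L M]]]]; [lra|lra|].
assert (HD : D r1).
{ destruct E as [E|E]; [now subst r1|].
  apply NNPP; intros HN. destruct (Rle_lt_or_eq_dec 0 r1 Hr1) as [H2|H2].
  - rewrite (X_right HP r1 H2 HN) in E. lra.
  - subst r1. rewrite X_0 in E. lra. }
assert (H1 := D_pos r1 HD).
assert (B : ga * X r1 ^ 2 / 2 < al + be * Y r1 / 3 - ga * Y r1 ^ 2 / 6).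
{ apply (X_max_bound r1 r1 HD H1). intros t Ht. apply M; lra. }
rewrite (Y_constant r1 HD), (al_eq HP), m_eq, be_eq in B.
assert (s ^ 2 <= X r1 ^ 2) by (apply pow_incr; lra).
assert (ga * s ^ 2 <= ga * X r1 ^ 2) by (apply Rmult_le_compat_l; [apply Rlt_le, (ga_pos HP)|easy]).
lra.
Qed.

(* A local maximum at sg followed by a lower local minimum at rho > sg is impossible, since
   K/r^2 + ga (X^2 - s^2)/2 would have to be <= 0 at sg and >= 0 at rho. *)
Lemma scalar_X_nondecreasing a b : 0 < a -> a < b -> D b -> X a <= X b.
Proof.
intros Ha Hab Hb. apply Rnot_lt_le; intros N.
assert (Hga := ga_pos HP). assert (HK := K_pos HP). assert (HXb := scalar_X_lt_s b Hb).
destruct (continuity_ab_maj X 0 b) as [sg [M1 Hsg]]; [lra| |].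
{ intros r _. apply continuity_pt_filterlim, (X_cont HP). }
assert (HXs : X a <= X sg) by (apply M1; lra).
assert (HXa := X_pos HP a (D_down b a Hb ltac:(lra))).
assert (Hsg' : 0 < sg < b).
{ split; apply Rnot_le_lt; intros L.
  - assert (E : sg = 0) by lra. rewrite E, X_0 in HXs. lra.
  - assert (E : sg = b) by lra. rewrite E in HXs. lra. }
assert (HDs : D sg) by (apply (D_down b); [easy|lra]).
destruct (near_end b (s - X b) Hb) as [n [Hn [HDn Hn']]]; [lra|].
destruct (continuity_ab_min X sg n) as [rho [M2 Hrho]]; [lra| |].
{ intros r _. apply continuity_pt_filterlim, (X_cont HP). }
assert (HXr : X rho <= X b) by (apply M2; lra).
assert (Hrho' : sg < rho < n).
{ split; apply Rnot_le_lt; intros L.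
  - assert (E : rho = sg) by lra. rewrite E in HXr. lra.
  - assert (E : rho = n) by lra. rewrite E in HXr.
    destruct (Hn' n (Rle_refl n)) as [H _]. apply Rabs_def2 in H. lra. }
assert (HDr : D rho) by (apply (D_down n); [easy|lra]).
assert (C1 : K * X sg / sg ^ 2 + f (X sg) (Y sg) <= 0).
{ apply (radial_local_max X p (fun t => K * X t / t ^ 2 + f (X t) (Y t)) sg (Rmin sg (b - sg))
    (X_der HP) p_der' HDs); [apply Rmin_glb_lt; lra|].
  intros t Ht. assert (L1 := Rmin_l sg (b - sg)). assert (L2 := Rmin_r sg (b - sg)).
  apply M1; lra. }
assert (C2 : 0 <= K * X rho / rho ^ 2 + f (X rho) (Y rho)).
{ apply (radial_local_min X p (fun t => K * X t / t ^ 2 + f (X t) (Y t)) rho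
    (Rmin (rho - sg) (n - rho)) (X_der HP) p_der' HDr); [apply Rmin_glb_lt; lra|].
  intros t Ht. assert (L1 := Rmin_l (rho - sg) (n - rho)). assert (L2 := Rmin_r (rho - sg) (n - rho)).
  apply M2; lra. }
assert (E : forall r, D r -> K * X r / r ^ 2 + f (X r) (Y r) =
  X r * (K / r ^ 2 + ga * (X r ^ 2 - s ^ 2) / 2)).
{ intros r Hr. assert (H0 := D_pos r Hr). unfold f, f_rhs.
  rewrite (Y_constant r Hr), (al_eq HP), m_eq, be_eq. field. lra. }
rewrite (E sg HDs) in C1. rewrite (E rho HDr) in C2.
assert (P1 := X_pos HP sg HDs). assert (P2 := X_pos HP rho HDr).
assert (D1 : K / sg ^ 2 + ga * (X sg ^ 2 - s ^ 2) / 2 <= 0).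
{ apply (Rmult_le_reg_l (X sg)); [easy|]. now rewrite Rmult_0_r. }
assert (D2 : 0 <= K / rho ^ 2 + ga * (X rho ^ 2 - s ^ 2) / 2).
{ apply (Rmult_le_reg_l (X rho)); [easy|]. now rewrite Rmult_0_r. }
assert (D3 : K / rho ^ 2 < K / sg ^ 2).
{ apply Rmult_lt_compat_l; [easy|].
  apply Rinv_lt_contravar; [apply Rmult_lt_0_compat; apply pow_lt; lra|].
  rewrite <- !Rsqr_pow2. apply Rsqr_incrst_1; lra. }
assert (D4 : X rho ^ 2 <= X sg ^ 2) by (apply pow_incr; lra).
assert (D5 : ga * X rho ^ 2 <= ga * X sg ^ 2) by (apply Rmult_le_compat_l; lra).
lra.
Qed.

Lemma scalar_increasing r : D r -> 0 < p r.
Proof.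
intros Hr. destruct (D_nbhd r Hr) as [e [He [Her HD]]].
apply (p_pos_of_symmetric r e Hr He).
- intros t Ht. apply scalar_X_nondecreasing; [lra|lra|apply HD; lra].
- intros t Ht. destruct (D_nbhd (r + t) (HD (r + t) ltac:(lra))) as [e' [He' [_ HD']]].
  apply (right_min_derive_ge0 X (r + t) _ e'); [apply (X_der HP), HD; lra|easy|].
  intros h Hh. apply scalar_X_nondecreasing; [lra|lra|apply HD'; lra].
- apply (right_min_derive_ge0 Y r _ e (Y_der HP r Hr) He).
  intros t Ht. rewrite !Y_constant; [lra|apply HD; lra|easy].
- rewrite (Y_constant r Hr), be_eq. lra.
Qed.
End Degenerate.
End Profile.

(** * Reduction to the rescaled system *)

(** With the limits as constants the extension is continuous on the whole line, so extrema can be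
    taken over closed intervals and pairs may reach past a finite end. *)
Definition extend (Rend : Rbar) (f0 l : R) (f : R -> R) (r : R) : R :=
  if Rle_dec r 0 then f0
  else if excluded_middle_informative (in_open Rend r) then f r else l.

Lemma extend_left Rend f0 l f r : r <= 0 -> extend Rend f0 l f r = f0.
Proof. intros Hr. unfold extend. destruct (Rle_dec r 0); [easy|lra]. Qed.

Lemma extend_inside Rend f0 l f r : in_open Rend r -> extend Rend f0 l f r = f r.
Proof.
intros Hr. unfold extend. destruct (Rle_dec r 0); [destruct Hr; lra|].
now destruct (excluded_middle_informative (in_open Rend r)).
Qed.

Lemma extend_right Rend f0 l f r : 0 < r -> ~ in_open Rend r -> extend Rend f0 l f r = l.
Proof.
intros Hr H. unfold extend. destruct (Rle_dec r 0); [lra|].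
now destruct (excluded_middle_informative (in_open Rend r)).
Qed.

Lemma in_open_interval Rend : Rbar_lt (Finite 0) Rend ->
  (exists Re, 0 < Re /\ forall r, in_open Rend r <-> 0 < r < Re) \/
  forall r, in_open Rend r <-> 0 < r.
Proof.
destruct Rend as [Re| |]; simpl; intros H; [left|right|easy].
- exists Re; split; [easy|]. intros r; unfold in_open; simpl; tauto.
- intros r; unfold in_open; simpl; tauto.
Qed.

Lemma in_open_nbhd Rend r : in_open Rend r -> locally r (in_open Rend).
Proof.
intros [H0 H]. apply filter_and.
- now apply (open_gt 0).
- destruct Rend as [Re| |]; simpl in *; [now apply (open_lt Re)| |easy].
  apply filter_true.
Qed.

Lemma extend_derive Rend f0 l f r d : in_open Rend r -> is_derive f r d ->
  is_derive (extend Rend f0 l f) r d.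
Proof.
intros Hr. apply (is_derive_ext_loc (K := R_AbsRing) (V := R_NormedModule) f).
apply filter_imp with (2 := in_open_nbhd Rend r Hr).
intros t Ht. now rewrite extend_inside.
Qed.

Lemma continuous_of_eps (f : R -> R) r :
  (forall e, 0 < e -> exists d, 0 < d /\ forall t, Rabs (t - r) < d -> Rabs (f t - f r) < e) ->
  continuous f r.
Proof.
intros H. apply filterlim_locally. intros e. destruct (H e (cond_pos e)) as [d [Hd Hd']].
exists (mkposreal d Hd). intros t Ht. apply Hd', Ht.
Qed.

Lemma at_right_0_eps (f : R -> R) l : filterlim f (at_right 0) (locally l) ->
  forall e, 0 < e -> exists d, 0 < d /\ forall r, 0 < r < d -> Rabs (f r - l) < e.
Proof.
intros H e He. apply (proj1 (filterlim_locally f l)) with (eps := mkposreal e He) in H.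
destruct H as [d Hd]. exists d; split; [apply cond_pos|]. intros r Hr. apply Hd; [|easy].
unfold ball; simpl; unfold AbsRing_ball, abs, minus, plus, opp; simpl.
rewrite Ropp_0, Rplus_0_r, Rabs_pos_eq; lra.
Qed.

Lemma extend_continuous Rend f0 l f : Rbar_lt (Finite 0) Rend ->
  (forall r, in_open Rend r -> continuous f r) ->
  filterlim f (at_right 0) (locally f0) -> filterlim f (end_filter Rend) (locally l) ->
  forall r, continuous (extend Rend f0 l f) r.
Proof.
intros HR Hc H0 Hl r.
destruct (total_order_T r 0) as [[L|L]|L].
- apply continuous_of_eps. intros e He. exists (- r); split; [lra|]. intros t Ht.
  apply Rabs_def2 in Ht. rewrite !extend_left by lra. now rewrite Rminus_diag, Rabs_R0.
- subst r. apply continuous_of_eps. intros e He.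
  destruct (at_right_0_eps f f0 H0 e He) as [d [Hd H]].
  assert (HD : exists d', 0 < d' /\ forall r, 0 < r < d' -> in_open Rend r).
  { destruct (in_open_interval Rend HR) as [[Re [HRe HI]]|HI].
    - exists Re; split; [easy|]. intros r Hr. now apply HI.
    - exists 1; split; [lra|]. intros r Hr. apply HI; lra. }
  destruct HD as [d' [Hd' HD]].
  assert (L1 := Rmin_l d d'). assert (L2 := Rmin_r d d').
  exists (Rmin d d'); split; [apply Rmin_glb_lt; lra|]. intros t Ht. apply Rabs_def2 in Ht.
  rewrite (extend_left _ _ _ _ 0) by lra.
  destruct (Rle_lt_dec t 0) as [Lt|Lt].
  + rewrite extend_left by easy. now rewrite Rminus_diag, Rabs_R0.
  + rewrite extend_inside by (apply HD; lra). apply H; lra.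
- destruct (classic (in_open Rend r)) as [Hr|Hr].
  + apply continuous_ext_loc with (g := f); [|now apply Hc].
    apply filter_imp with (2 := in_open_nbhd Rend r Hr).
    intros t Ht. now rewrite extend_inside.
  + destruct Rend as [Re| |]; [|exfalso; now apply Hr|easy].
    simpl in HR, Hl.
    assert (HRr : Re <= r) by (apply Rnot_lt_le; intros N; now apply Hr).
    apply continuous_of_eps. intros e He. rewrite (extend_right _ _ _ _ r) by easy.
    apply (proj1 (filterlim_locally f l)) with (eps := mkposreal e He) in Hl.
    destruct Hl as [d Hd]. assert (Pd := cond_pos d).
    assert (L1 := Rmin_l d r). assert (L2 := Rmin_r d r).
    exists (Rmin d r); split; [apply Rmin_glb_lt; lra|]. intros t Ht. apply Rabs_def2 in Ht.
    destruct (Rle_lt_dec Re t) as [Lt|Lt].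
    * rewrite extend_right; [now rewrite Rminus_diag, Rabs_R0|lra|].
      intros [_ N]. simpl in N. lra.
    * rewrite extend_inside by (split; [lra|easy]). apply Hd; [|easy].
      apply Rabs_def1; unfold minus, plus, opp; simpl; lra.
Qed.

Lemma extend_limit Rend f0 l f : Rbar_lt (Finite 0) Rend ->
  filterlim f (end_filter Rend) (locally l) ->
  forall e, 0 < e -> exists N, forall r, N <= r -> Rabs (extend Rend f0 l f r - l) < e.
Proof.
intros HR Hl e He. destruct Rend as [Re| |]; [| |easy]; simpl in HR, Hl.
- exists Re. intros r Hr. rewrite extend_right; [now rewrite Rminus_diag, Rabs_R0|lra|].
  intros [_ N]. simpl in N. lra.
- apply (proj1 (filterlim_locally f l)) with (eps := mkposreal e He) in Hl.
  destruct Hl as [N HN]. exists (Rmax 0 N + 1).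
  assert (L1 := Rmax_l 0 N). assert (L2 := Rmax_r 0 N).
  intros r Hr. rewrite extend_inside by (split; [lra|easy]). apply HN; lra.
Qed.

(** A bounded derivative makes f Lipschitz near 0, hence Cauchy there. This supplies the value y0 of
    [Y] at the origin, since only the limit of v' is given. *)
Lemma limit_0_of_derive_limit (f : R -> R) d l : 0 < d ->
  (forall r, 0 < r < d -> ex_derive f r) -> filterlim (Derive f) (at_right 0) (locally l) ->
  exists f0, filterlim f (at_right 0) (locally f0).
Proof.
intros Hd Hf Hl. destruct (at_right_0_eps _ _ Hl 1 Rlt_0_1) as [d1 [Hd1 H1]].
assert (C : 0 < Rabs l + 1) by (generalize (Rabs_pos l); lra).
assert (Lip : forall a b, 0 < a -> a < b -> b < Rmin d d1 ->
  Rabs (f b - f a) <= (Rabs l + 1) * (b - a)).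
{ intros a b Ha Hab Hb. assert (L1 := Rmin_l d d1). assert (L2 := Rmin_r d d1).
  destruct (is_derive_MVT f (Derive f) a b Hab) as [c [Hc E]].
  { intros t Ht. apply Derive_correct, Hf; lra. }
  rewrite E, Rabs_mult, (Rabs_pos_eq (b - a)) by lra. apply Rmult_le_compat_r; [lra|].
  assert (H2 := H1 c ltac:(lra)). assert (H3 := Rabs_triang (Derive f c - l) l).
  replace (Derive f c - l + l) with (Derive f c) in H3 by ring. lra. }
apply (proj1 (filterlim_locally_cauchy f)). intros e.
set (d2 := Rmin (Rmin d d1) (e / (Rabs l + 1))).
assert (He : 0 < e / (Rabs l + 1)) by (apply Rdiv_lt_0_compat; [apply cond_pos|easy]).
assert (Hd2 : 0 < d2) by (repeat apply Rmin_glb_lt; lra).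
assert (L1 := Rmin_l (Rmin d d1) (e / (Rabs l + 1))).
assert (L2 := Rmin_r (Rmin d d1) (e / (Rabs l + 1))). fold d2 in L1, L2.
assert (Close : forall a b, 0 < a -> a < b -> b < d2 -> Rabs (f b - f a) < e).
{ intros a b Ha Hab Hb. apply Rle_lt_trans with (1 := Lip a b Ha Hab ltac:(lra)).
  apply Rlt_le_trans with ((Rabs l + 1) * (e / (Rabs l + 1))).
  - apply Rmult_lt_compat_l; lra.
  - right; field; lra. }
exists (fun r => 0 < r < d2). split.
- exists (mkposreal d2 Hd2). intros r Hr H0.
  unfold ball in Hr; simpl in Hr; unfold AbsRing_ball, abs, minus, plus, opp in Hr; simpl in Hr.
  apply Rabs_def2 in Hr. lra.
- intros a b Ha Hb. unfold ball; simpl; unfold AbsRing_ball, abs, minus, plus, opp; simpl.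
  change (Rabs (f b - f a) < e).
  destruct (total_order_T a b) as [[L|L]|L].
  + apply Close; lra.
  + subst b. rewrite Rminus_diag, Rabs_R0. apply cond_pos.
  + rewrite Rabs_minus_sym. apply Close; lra.
Qed.

Lemma filterlim_scale (F : (R -> Prop) -> Prop) {FF : Filter F} (f : R -> R) c l :
  filterlim f F (locally l) -> filterlim (fun r => c * f r) F (locally (c * l)).
Proof.
intros H. apply (filterlim_comp _ _ _ f (fun t => c * t) F (locally l)); [easy|].
exact (filterlim_scal_r (K := R_AbsRing) (V := R_NormedModule) c l).
Qed.

Lemma end_filter_filter Rend : Filter (end_filter Rend).
Proof. destruct Rend; simpl; typeclasses eauto. Qed.

(** * Algebra of the rescaling *)

Lemma sqrt_2_3 : sqrt (2 / 3) = sqrt 6 / 3.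
Proof.
assert (H := sqrt_sqrt 6 ltac:(lra)). assert (P := sqrt_lt_R0 6 ltac:(lra)).
apply sqrt_lem_1; nra.
Qed.

Lemma inv_sqrt_6 : / sqrt 6 = sqrt 6 / 6.
Proof.
assert (H := sqrt_sqrt 6 ltac:(lra)). assert (P := sqrt_lt_R0 6 ltac:(lra)).
apply (Rmult_eq_reg_l (sqrt 6)); [|lra]. rewrite Rinv_r by lra. lra.
Qed.

Lemma h_fun_rescaled a b c e u v : e ^ 2 = 1 ->
  f_rhs (a ^ 2) (e * b ^ 2) (c ^ 2) (sqrt 2 * u) (- e * sqrt 6 * v) = sqrt 2 * h_fun a b c u v.
Proof.
intros He. assert (H6 : sqrt 6 ^ 2 = 6) by (apply pow2_sqrt; lra).
assert (H2 : sqrt 2 ^ 2 = 2) by (apply pow2_sqrt; lra).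
unfold f_rhs, h_fun. rewrite sqrt_2_3.
replace ((- e * sqrt 6 * v) ^ 2) with (6 * v ^ 2) by (rewrite !Rpow_mult_distr, H6;
  replace ((- e) ^ 2) with (e ^ 2) by ring; rewrite He; ring).
replace ((sqrt 2 * u) ^ 2) with (2 * u ^ 2) by (rewrite Rpow_mult_distr, H2; ring).
replace (e * b ^ 2 * (- e * sqrt 6 * v)) with (- (e ^ 2) * (sqrt 6 * b ^ 2 * v)) by ring.
rewrite He. field.
Qed.

Lemma g_fun_rescaled a b c e u v : e ^ 2 = 1 ->
  g_rhs (a ^ 2) (e * b ^ 2) (c ^ 2) (sqrt 2 * u) (- e * sqrt 6 * v) =
  - e * sqrt 6 * g_fun a b c u v.
Proof.
intros He. assert (H6 : sqrt 6 ^ 2 = 6) by (apply pow2_sqrt; lra).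
assert (H2 : sqrt 2 ^ 2 = 2) by (apply pow2_sqrt; lra).
unfold g_rhs, g_fun. rewrite inv_sqrt_6.
replace ((- e * sqrt 6 * v) ^ 2) with (6 * v ^ 2) by (rewrite !Rpow_mult_distr, H6;
  replace ((- e) ^ 2) with (e ^ 2) by ring; rewrite He; ring).
replace ((sqrt 2 * u) ^ 2) with (2 * u ^ 2) by (rewrite Rpow_mult_distr, H2; ring).
replace (e * b ^ 2 * (- e * sqrt 6 * v)) with (- (e ^ 2) * (sqrt 6 * b ^ 2 * v)) by ring.
rewrite He.
replace (- e * sqrt 6 * (v * (- a ^ 2 - sqrt 6 / 6 * b ^ 2 * v + c ^ 2 * (u ^ 2 + v ^ 2)) +
  sqrt 6 / 6 * b ^ 2 * u ^ 2)) with
  (- e * sqrt 6 * (v * (- a ^ 2 - sqrt 6 / 6 * b ^ 2 * v + c ^ 2 * (u ^ 2 + v ^ 2))) -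
   e * sqrt 6 ^ 2 / 6 * b ^ 2 * u ^ 2) by field.
rewrite H6. field.
Qed.

Lemma s_plus_pos a b c : 0 < b ^ 2 -> 0 < c ^ 2 -> 0 < s_plus a b c.
Proof.
intros Hb Hc. unfold s_plus. assert (P := sqrt_pos (b ^ 4 + 24 * a ^ 2 * c ^ 2)).
apply Rdiv_lt_0_compat; lra.
Qed.

(** The radicand in [s_plus] is the discriminant of this quadratic. The relation, in the form
    [al_eq], makes (s, m) a zero of both [f_rhs] and [g_rhs]. *)
Lemma s_plus_root a b c : 0 < c ^ 2 ->
  2 * c ^ 2 * s_plus a b c ^ 2 = b ^ 2 * s_plus a b c + 3 * a ^ 2.
Proof.
intros Hc. unfold s_plus. set (d := sqrt (b ^ 4 + 24 * a ^ 2 * c ^ 2)).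
assert (Hd : d ^ 2 = b ^ 4 + 24 * a ^ 2 * c ^ 2).
{ apply pow2_sqrt. assert (0 <= (b ^ 2) ^ 2) by apply pow2_ge_0.
  assert (0 <= a ^ 2 * c ^ 2) by (apply Rmult_le_pos; [apply pow2_ge_0|lra]).
  replace (b ^ 4) with ((b ^ 2) ^ 2) by ring. lra. }
assert (c <> 0) by (intros E; rewrite E in Hc; simpl in Hc; lra).
replace (2 * c ^ 2 * ((b ^ 2 + d) / (4 * c ^ 2)) ^ 2) with
  ((b ^ 4 + 2 * b ^ 2 * d + d ^ 2) / (8 * c ^ 2)) by (field; easy).
rewrite Hd. field. easy.
Qed.

(** For b^2, c^2 > 0 the second factor is positive, so the three cases of the theorem become
    comparisons of c^2 s with b^2. *)
Lemma s_plus_compare a b c : 0 < c ^ 2 ->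
  (c ^ 2 * s_plus a b c - b ^ 2) * (2 * (c ^ 2 * s_plus a b c) + b ^ 2) =
  3 * a ^ 2 * c ^ 2 - b ^ 4.
Proof.
intros Hc. assert (H := s_plus_root a b c Hc).
replace ((c ^ 2 * s_plus a b c - b ^ 2) * (2 * (c ^ 2 * s_plus a b c) + b ^ 2)) with
  (c ^ 2 * (2 * c ^ 2 * s_plus a b c ^ 2) - c ^ 2 * b ^ 2 * s_plus a b c - b ^ 4) by ring.
rewrite H. ring.
Qed.

(* The sign e makes the system cooperative in (sqrt 2 u, - e sqrt 6 v): it is 1 when
   s_plus <= b^2/c^2 and -1 otherwise. *)
Lemma solution_profile (a b c e : R) (k : Z) (Rend : Rbar) (u v : R -> R) :
  e ^ 2 = 1 -> 0 < b ^ 2 -> 0 < c ^ 2 -> (k <> 0)%Z -> Rbar_lt (Finite 0) Rend ->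
  is_solution a b c k Rend u v ->
  filterlim u (at_right 0) (locally 0) ->
  filterlim (Derive v) (at_right 0) (locally 0) ->
  filterlim u (end_filter Rend) (locally (s_plus a b c / sqrt 2)) ->
  filterlim v (end_filter Rend) (locally (- (s_plus a b c / sqrt 6))) ->
  (forall r, in_open Rend r -> 0 < u r /\ v r < 0) ->
  exists y0 X Y, profile (a ^ 2) (e * b ^ 2) (c ^ 2) (IZR k ^ 2) (s_plus a b c)
    (e * s_plus a b c) y0 (in_open Rend) X (fun r => sqrt 2 * Derive u r)
    Y (fun r => - e * sqrt 6 * Derive v r) /\
    forall r, in_open Rend r -> Y r = - e * sqrt 6 * v r.
Proof.
intros He Hb Hc Hk HR Hsol Hu0 Hv0 Hu Hv Hpos.
assert (P2 := sqrt_lt_R0 2 ltac:(lra)). assert (P6 := sqrt_lt_R0 6 ltac:(lra)).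
assert (Hs := s_plus_pos a b c Hb Hc).
assert (FF := end_filter_filter Rend).
assert (HD : exists d, 0 < d /\ forall r, 0 < r < d -> in_open Rend r).
{ destruct (in_open_interval Rend HR) as [[Re [HRe HI]]|HI].
  - exists Re; split; [easy|]. intros r Hr. now apply HI.
  - exists 1; split; [lra|]. intros r Hr. apply HI; lra. }
destruct HD as [d [Hd HD]].
destruct (limit_0_of_derive_limit v d 0 Hd) as [v0 Hv0'];
  [intros r Hr; now apply (Hsol r (HD r Hr))|easy|].
set (s := s_plus a b c) in *.
set (U := fun r => sqrt 2 * u r). set (V := fun r => - e * sqrt 6 * v r).
assert (LU : filterlim U (end_filter Rend) (locally s)).
{ replace s with (sqrt 2 * (s / sqrt 2)) by (field; lra). now apply filterlim_scale. }
assert (LV : filterlim V (end_filter Rend) (locally (e * s))).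
{ replace (e * s) with (- e * sqrt 6 * - (s / sqrt 6)) by (field; lra). now apply filterlim_scale. }
assert (LU0 : filterlim U (at_right 0) (locally 0)).
{ replace (locally 0) with (locally (sqrt 2 * 0)) by (f_equal; ring).
  apply filterlim_scale; [typeclasses eauto|easy]. }
assert (LV0 : filterlim V (at_right 0) (locally (- e * sqrt 6 * v0))).
{ apply filterlim_scale; [typeclasses eauto|easy]. }
assert (DU : forall r, in_open Rend r -> is_derive U r (sqrt 2 * Derive u r)).
{ intros r Hr. destruct (Hsol r Hr) as [H _].
  apply (is_derive_scal u r (sqrt 2)). now apply Derive_correct. }
assert (DV : forall r, in_open Rend r -> is_derive V r (- e * sqrt 6 * Derive v r)).
{ intros r Hr. destruct (Hsol r Hr) as [_ [_ [H _]]].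
  apply (is_derive_scal v r (- e * sqrt 6)). now apply Derive_correct. }
exists (- e * sqrt 6 * v0), (extend Rend 0 s U), (extend Rend (- e * sqrt 6 * v0) (e * s) V).
split; [|intros r Hr; now rewrite extend_inside].
constructor.
- easy.
- rewrite <- Rsqr_pow2. apply Rsqr_pos_lt. now apply eq_IZR_contrapositive.
- easy.
- rewrite Rpow_mult_distr, He. ring.
- replace (e * b ^ 2 * (e * s)) with (e ^ 2 * (b ^ 2 * s)) by ring. rewrite He.
  assert (H := s_plus_root a b c Hc). fold s in H. lra.
- now apply in_open_interval.
- apply extend_continuous; try easy. intros r Hr.
  apply (ex_derive_continuous (K := R_AbsRing) (V := R_NormedModule) U).
  eexists; now apply DU.
- apply extend_continuous; try easy. intros r Hr.
  apply (ex_derive_continuous (K := R_AbsRing) (V := R_NormedModule) V).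
  eexists; now apply DV.
- now apply extend_limit.
- now apply extend_limit.
- intros r; apply extend_left.
- intros r; apply extend_left.
- intros r; apply extend_right.
- intros r; apply extend_right.
- intros r Hr. rewrite extend_inside by easy. destruct (Hpos r Hr).
  now apply Rmult_lt_0_compat.
- intros r Hr. apply extend_derive; [easy|now apply DU].
- intros r Hr. rewrite !extend_inside by easy. unfold U, V.
  rewrite h_fun_rescaled by easy. assert (Hr0 := proj1 Hr).
  destruct (Hsol r Hr) as [_ [H [_ [_ [E _]]]]]. rewrite <- E.
  evar_last; [apply (is_derive_scal (Derive u) r (sqrt 2)), Derive_correct, H|].
  simpl. field. lra.
- intros r Hr. apply extend_derive; [easy|now apply DV].
- intros r Hr. rewrite !extend_inside by easy. unfold U, V.
  rewrite g_fun_rescaled by easy. assert (Hr0 := proj1 Hr).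
  destruct (Hsol r Hr) as [_ [_ [_ [H [_ E]]]]]. rewrite <- E.
  evar_last; [apply (is_derive_scal (Derive v) r (- e * sqrt 6)), Derive_correct, H|].
  simpl. field. lra.
- assert (L : filterlim (fun r => - e * sqrt 6 * Derive v r) (at_right 0)
    (locally (- e * sqrt 6 * 0))) by (apply filterlim_scale; [typeclasses eauto|easy]).
  rewrite Rmult_0_r in L. intros t Ht.
  destruct (at_right_0_eps _ _ L t Ht) as [d' [Hd' H]]. exists d'; split; [easy|].
  intros r Hr. specialize (H r Hr). now rewrite Rminus_0_r in H.
Qed.

Theorem mainTheorem2 (a b c : R) (k : Z) (Rend : Rbar) (u v : R -> R) :
  0 < b ^ 2 -> 0 < c ^ 2 -> (k <> 0)%Z -> Rbar_lt (Finite 0) Rend ->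
  is_solution a b c k Rend u v ->
  filterlim u (at_right 0) (locally 0) ->
  filterlim (Derive v) (at_right 0) (locally 0) ->
  filterlim u (end_filter Rend) (locally (s_plus a b c / sqrt 2)) ->
  filterlim v (end_filter Rend) (locally (- (s_plus a b c / sqrt 6))) ->
  (forall r, in_open Rend r -> 0 < u r /\ v r < 0) ->
  (b ^ 4 < 3 * a ^ 2 * c ^ 2 ->
     forall r, in_open Rend r -> 0 < Derive u r /\ 0 < Derive v r) /\
  (b ^ 4 = 3 * a ^ 2 * c ^ 2 ->
     forall r, in_open Rend r -> 0 < Derive u r /\ v r = - (s_plus a b c / sqrt 6)) /\
  (3 * a ^ 2 * c ^ 2 < b ^ 4 ->
     forall r, in_open Rend r -> 0 < Derive u r /\ Derive v r < 0).
Proof.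
intros Hb Hc Hk HR Hsol Hu0 Hv0 Hu Hv Hpos.
assert (P2 := sqrt_lt_R0 2 ltac:(lra)). assert (P6 := sqrt_lt_R0 6 ltac:(lra)).
assert (Hs := s_plus_pos a b c Hb Hc).
assert (Hroot := s_plus_root a b c Hc). assert (Hcmp := s_plus_compare a b c Hc).
set (s := s_plus a b c) in *.
assert (Hcs : 0 < c ^ 2 * s) by now apply Rmult_lt_0_compat.
assert (Hx : forall x, 0 < sqrt 2 * x -> 0 < x).
{ intros x H. apply (Rmult_lt_reg_l (sqrt 2)); [easy|lra]. }
assert (Hy : forall x, 0 < sqrt 6 * x -> 0 < x).
{ intros x H. apply (Rmult_lt_reg_l (sqrt 6)); [easy|lra]. }
assert (Hb4 : b ^ 4 = (b ^ 2) ^ 2) by ring.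
split; [|split]; intros Hab.
(* Here Y = sqrt 6 v, be = - b^2 and m = - s, so ga m < be means c^2 s > b^2. *)
- destruct (solution_profile a b c (-1) k Rend u v) as [y0 [X [Y [HP HY]]]]; try easy; [ring|].
  fold s in HP.
  assert (Hgt : b ^ 2 < c ^ 2 * s).
  { apply Rnot_le_lt; intros N.
    assert (0 <= (b ^ 2 - c ^ 2 * s) * (2 * (c ^ 2 * s) + b ^ 2)) by (apply Rmult_le_pos; lra).
    lra. }
  assert (Hal : (-1 * b ^ 2) ^ 2 < 3 * a ^ 2 * c ^ 2) by lra.
  assert (HYneg : forall r, in_open Rend r -> Y r < 0).
  { intros r Hr. rewrite HY by easy. destruct (Hpos r Hr) as [_ Hvr].
    assert (0 < sqrt 6 * - v r) by (apply Rmult_lt_0_compat; lra). lra. }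
  (* Positivity of [g] is also required at r = 0, and [g_pos_neg] needs a negative value there. *)
  assert (Hy0 := Y_0_neg _ _ _ _ _ _ _ _ _ _ _ _ HP ltac:(lra) Hal HYneg).
  intros r Hr.
  destruct (profile_increasing _ _ _ _ _ _ _ _ _ _ _ _ HP) with (r := r) as [Hp Hq]; [lra| | |easy|].
  + intros t x Ht Hle. apply g_pos_neg; try easy; [lra|].
    destruct Ht as [Ht|Ht]; [subst t; now rewrite (Y_0 _ _ _ _ _ _ _ _ _ _ _ _ HP)|now apply HYneg].
  + intros y Hy1 Hy2.
    assert (c ^ 2 * (-1 * s) <= c ^ 2 * y) by (apply Rmult_le_compat_l; lra).
    (* Both - c^2 y and c^2 s exceed b^2, so the second factor is larger than 3 b^2. *)
    assert (0 < b ^ 2 * (-1 * b ^ 2 - 2 * c ^ 2 * (y + -1 * s))); [|lra].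
    apply Rmult_lt_0_compat; lra.
  + split; [now apply Hx|apply Hy; lra].
- destruct (solution_profile a b c 1 k Rend u v) as [y0 [X [Y [HP HY]]]]; try easy; [ring|].
  fold s in HP.
  assert (Heq : 1 * b ^ 2 = c ^ 2 * s).
  { assert (E : (c ^ 2 * s - b ^ 2) * (2 * (c ^ 2 * s) + b ^ 2) = 0) by lra.
    apply Rmult_integral in E. lra. }
  assert (HYpos : forall r, in_open Rend r -> 0 < Y r).
  { intros r Hr. rewrite HY by easy. destruct (Hpos r Hr) as [_ Hvr].
    assert (0 < sqrt 6 * - v r) by (apply Rmult_lt_0_compat; lra). lra. }
  intros r Hr. split.
  + apply Hx. apply (scalar_increasing _ _ _ _ _ _ _ _ _ _ _ _ HP Heq); try easy. ring.
  + assert (E := Y_constant _ _ _ _ _ _ _ _ _ _ _ _ HP Heq (Rmult_1_l s) HYpos r Hr).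
    rewrite HY in E by easy. rewrite <- E. field. lra.
- destruct (solution_profile a b c 1 k Rend u v) as [y0 [X [Y [HP HY]]]]; try easy; [ring|].
  fold s in HP.
  assert (Hlt : c ^ 2 * s < b ^ 2).
  { apply Rnot_le_lt; intros N.
    assert (0 <= (c ^ 2 * s - b ^ 2) * (2 * (c ^ 2 * s) + b ^ 2)) by (apply Rmult_le_pos; lra).
    lra. }
  intros r Hr.
  destruct (profile_increasing _ _ _ _ _ _ _ _ _ _ _ _ HP) with (r := r) as [Hp Hq]; [lra| | |easy|].
  + intros t x Ht Hle. apply g_pos_pos; try easy; lra.
  + intros y Hy1 Hy2.
    assert (c ^ 2 * (1 * s) <= c ^ 2 * y) by (apply Rmult_le_compat_l; lra).
    (* The root relation divided by s, with 3 a^2 >= 0 dropped; hence 2 ga (y + m) >= 4 c^2 s >= 2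
       b^2. *)
    assert (b ^ 2 <= 2 * (c ^ 2 * s)).
    { apply (Rmult_le_reg_r s); [easy|]. assert (0 <= a ^ 2) by apply pow2_ge_0. lra. }
    apply Rmult_lt_0_compat; lra.
  + split; [now apply Hx|].
    assert (0 < - Derive v r) by (apply Hy; lra). lra.
Qed.
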